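(* Let $j\in\{0,1\}$ and let $k,i$ be integers with $k\geq i\geq 2$ and $(2k+j)/2>2$. Let $C_j(k,i;m,n)$ denote the number of partitions of $n$ with exactly $m$ parts that belong to the set $\mathbb{C}_j(k,i)$ (defined in the context). Then $$\sum_{m,n\geq0}C_j(k,i;m,n)x^mq^n=\sum_{N_1\geq \cdots\geq N_{k-1}\geq0}\frac{q^{2(N_1^2+\cdots+N_{k-1}^2+N_i+\cdots+N_{k-1})}(-q^{1-2N_2};q^2)_{N_2}(-xq^{1+2N_1};q^2)_\infty\, x^{N_1+\cdots+N_{k-1}}}{(q^2;q^2)_{N_1-N_2}\cdots(q^2;q^2)_{N_{k-2}-N_{k-1}} (q^{4-2j};q^{4-2j})_{N_{k-1}}}.$$
   Context: Notation: $(a;q)_\infty=\prod_{m=0}^\infty(1-aq^m)$ and $(a;q)_n=(a;q)_\infty/(aq^n;q)_\infty=\prod_{m=0}^{n-1}(1-aq^m)$. The sum runs over integers $N_1\ge\cdots\ge N_{k-1}\ge 0$; when $i=k$ the sum $N_i+\cdots+N_{k-1}$ is empty; when $k=2$ (which forces $j=1$, $i=2$) one takes $N_2=0$, so $(-q^{1-2N_2};q^2)_{N_2}=1$ and the denominator is $(q^{2};q^{2})_{N_1}$. For a partition $\lambda$ (the empty one allowed), $f_t(\lambda)$ is the number of parts equal to $t$, with $f_0(\lambda)=0$. $\mathbb{C}_1(k,i)$ is the set of partitions $\lambda$ such that (1) $f_1(\lambda)+f_2(\lambda)\le i-1$; (2) $f_{2t+1}(\lambda)\le 1$ for all $t\ge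 0$; (3) $f_{2t}(\lambda)+f_{2t+1}(\lambda)+f_{2t+2}(\lambda)\le k-1$ for all $t\ge 0$. $\mathbb{C}_0(k,i)$ is the set of $\lambda\in\mathbb{C}_1(k,i)$ such that in addition (4) whenever $f_{2t}(\lambda)+f_{2t+1}(\lambda)+f_{2t+2}(\lambda)=k-1$, one has $tf_{2t}(\lambda)+tf_{2t+1}(\lambda)+(t+1)f_{2t+2}(\lambda)\equiv O_\lambda(2t+1)+i-1\pmod 2$, where $O_\lambda(N)$ is the number of odd parts of $\lambda$ not exceeding $N$. *)

(* Defs.v *)
From HB Require Import structures.
From mathcomp Require Import all_boot all_order all_algebra.
From mathcomp Require Import boolp classical_sets.

Set Implicit Arguments.
Unset Strict Implicit.
Unset Printing Implicit Defensive.

Import GRing.Theory.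
Local Open Scope ring_scope.

Record fps (A : Type) := Fps { fcoef : nat -> A }.

HB.instance Definition _ (A : Type) := gen_eqMixin (fps A).
HB.instance Definition _ (A : Type) := gen_choiceMixin (fps A).

Lemma fpsP (A : Type) (f g : fps A) :
  (forall n, fcoef f n = fcoef g n) -> f = g.
Proof. by case: f g => [f] [g] /= /funext ->. Qed.

Section FpsRing.
Variable A : idomainType.
Implicit Types f g h : fps A.

Definition fps_zero : fps A := Fps (fun=> 0).
Definition fps_one : fps A := Fps (fun n => (n == 0)%N%:R).
Definition fps_opp f : fps A := Fps (fun n => - fcoef f n).
Definition fps_add f g : fps A := Fps (fun n => fcoef f n + fcoef g n).
Definition fps_mul f g : fps A :=
  Fps (fun n => \sum_(i < n.+1) fcoef f i * fcoef g (n - i)).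

Fact fps_addA : associative fps_add.
Proof. by move=> f g h; apply: fpsP => n /=; rewrite addrA. Qed.
Fact fps_addC : commutative fps_add.
Proof. by move=> f g; apply: fpsP => n /=; rewrite addrC. Qed.
Fact fps_add0 : left_id fps_zero fps_add.
Proof. by move=> f; apply: fpsP => n /=; rewrite add0r. Qed.
Fact fps_addN : left_inverse fps_zero fps_opp fps_add.
Proof. by move=> f; apply: fpsP => n /=; rewrite addNr. Qed.

HB.instance Definition _ :=
  GRing.isZmodule.Build (fps A) fps_addA fps_addC fps_add0 fps_addN.

Let T n f : {poly A} := \poly_(i < n.+1) fcoef f i.

Let coefT n f i : (i <= n)%N -> (T n f)`_i = fcoef f i.
Proof. by move=> le_in; rewrite coef_poly ltnS le_in. Qed.

Let fcoef_mul n f g i : (i <= n)%N ->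
  fcoef (fps_mul f g) i = (T n f * T n g)`_i.
Proof.
move=> le_in; rewrite coefM /=; apply: eq_bigr => k _.
have le_kn : (k <= n)%N by rewrite (leq_trans _ le_in) // -ltnS.
by rewrite !coefT // (leq_trans (leq_subr _ _)).
Qed.

Fact fps_mulC : commutative fps_mul.
Proof.
by move=> f g; apply: fpsP => n; rewrite !(@fcoef_mul n) // mulrC.
Qed.

Fact fps_mulA : associative fps_mul.
Proof.
move=> f g h; apply: fpsP => n.
transitivity ((T n f * (T n g * T n h))`_n).
  rewrite (@fcoef_mul n) // !coefM; apply: eq_bigr => i _.
  by congr (_ * _); rewrite coefT ?leq_subr // (@fcoef_mul n) ?leq_subr.
rewrite mulrA (@fcoef_mul n) // !coefM; apply: eq_bigr => i _.
by congr (_ * _); rewrite coefT -1?ltnS // (@fcoef_mul n) -1?ltnS.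
Qed.

Fact fps_mul1 : left_id fps_one fps_mul.
Proof.
move=> f; apply: fpsP => n /=; rewrite big_ord_recl /= mul1r subn0.
by rewrite big1 ?addr0 // => i _; rewrite mul0r.
Qed.

Fact fps_mulDl : left_distributive fps_mul fps_add.
Proof.
move=> f g h; apply: fpsP => n /=; rewrite -big_split /=.
by apply: eq_bigr => i _; rewrite mulrDl.
Qed.

Fact fps_one_neq0 : fps_one != 0.
Proof.
by apply/eqP => /(congr1 (fun f => fcoef f 0)) /eqP; rewrite /= oner_eq0.
Qed.

HB.instance Definition _ := GRing.Zmodule_isComNzRing.Build (fps A)
  fps_mulA fps_mulC fps_mul1 fps_mulDl fps_one_neq0.

Definition fps_unit : pred (fps A) := fun f => `[< exists g, g * f = 1 >].
Definition fps_inv f : fps A :=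
  if fps_unit f then xget 0 [set g | g * f = 1]%classic else f.

Fact fps_mulVr : {in fps_unit, left_inverse 1 fps_inv *%R}.
Proof.
move=> f uf; rewrite /fps_inv (_ : fps_unit f) //.
by move/asboolP: uf => /xgetPex.
Qed.
Fact fps_unitP f g : g * f = 1 -> fps_unit f.
Proof. by move=> gf; apply/asboolP; exists g. Qed.
Fact fps_inv_out : {in [predC fps_unit], fps_inv =1 id}.
Proof. by move=> f /negbTE nuf; rewrite /fps_inv [fps_unit f]nuf. Qed.

HB.instance Definition _ := GRing.ComNzRing_hasMulInverse.Build (fps A)
  fps_mulVr fps_unitP fps_inv_out.

Fact fps_neq0_min f : f != 0 ->
  exists2 m, fcoef f m != 0 & forall i, (i < m)%N -> fcoef f i = 0.
Proof.
move=> f0; have [|m fm mmin] := @ex_minnP (fun m => fcoef f m != 0).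
  apply: contra_notP (negP f0) => nf; apply/eqP/fpsP => n.
  by apply/eqP; apply: contra_notT nf; exists n.
exists m => // i; rewrite ltnNge => /negP ltim; apply/eqP.
by apply: contra_notT ltim; apply: mmin.
Qed.

Fact fps_integral : GRing.integral_domain_axiom (fps A).
Proof.
move=> f g fg0; case: (eqVneq f 0) => //= /fps_neq0_min[m fm lm].
apply/negPn/negP => /fps_neq0_min[p gp lp].
move/(congr1 (fun h => fcoef h (m + p)))/eqP: fg0; apply/negP => /=.
have ltm : (m < (m + p).+1)%N by rewrite ltnS leq_addr.
rewrite (bigD1 (Ordinal ltm)) //= big1 ?addr0 ?addKn ?mulf_neq0 // => i nim.
have [/lm ->|] := ltnP i m; first by rewrite mul0r.
rewrite leq_eqVlt eq_sym (negbTE (nim : (i != m :> nat))) /= => ltmi.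
rewrite lp ?mulr0 // ltn_subLR ?ltn_add2r // -ltnS; exact: ltn_ord.
Qed.

HB.instance Definition _ :=
  GRing.ComUnitRing_isIntegral.Build (fps A) fps_integral.

End FpsRing.

(** The identity is between formal series.  We compute in [K], the fraction
    field of Z[x][[q]]: it contains Z[x]((q)), so negative powers of q and the
    quotients of the statement are the field operations, and it carries the
    q-adic topology, used for the infinite product and the infinite sums. *)
Notation ZXq := (fps {poly int}).

Definition K : fieldType := {fraction ZXq}.

Definition q : K :=
  tofrac (Fps (fun n => (n == 1)%N%:R) : ZXq).

Definition x : K :=
  tofrac (Fps (fun n => if n == 0%N then 'X else 0) : ZXq).

Definition qsmall (M : nat) (z : K) : Prop :=
  exists f : ZXq, z = q ^+ M * tofrac f.

Definition qcvg (u : nat -> K) (l : K) : Prop :=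
  forall M : nat, exists n0 : nat,
    forall n : nat, (n0 <= n)%N -> qsmall M (u n - l).

(** q-adic limits are unique; [qlim u] is 0 by default if there is none. *)
Definition qlim (u : nat -> K) : K := xget 0 [set l | qcvg u l]%classic.

(** Unconditional q-adic summation over the indices satisfying D: the finite
    partial sums converge to s along the finite sets of indices, given as
    duplicate-free sequences. *)
Definition has_qsum (I : eqType) (D : pred I) (F : I -> K) (s : K) : Prop :=
  forall M : nat, exists S : seq I,
    forall S' : seq I, uniq S' -> {subset S <= S'} ->
      qsmall M (\sum_(i <- S' | D i) F i - s).

(** q-Pochhammer symbols (a; p)_n and (a; p)_oo with base p. *)
Definition qpoch (a p : K) (n : nat) : K := \prod_(0 <= m < n) (1 - a * p ^+ m).
Definition qpoch_inf (a p : K) : K := qlim (qpoch a p).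

Definition is_partition (l : seq nat) : bool := sorted geq l && (0%N \notin l).

(** The parts of a partition are positive, so [mult 0 l] is then 0. *)
Definition mult (t : nat) (l : seq nat) : nat := count_mem t l.

Definition odd_upto (l : seq nat) (N : nat) : nat :=
  count (fun p => odd p && (p <= N)%N) l.

Definition C1 (k i : nat) (l : seq nat) : Prop :=
  [/\ is_partition l,
      (mult 1 l + mult 2 l <= i - 1)%N,
      forall t, (mult (2 * t + 1) l <= 1)%N &
      forall t, (mult (2 * t) l + mult (2 * t + 1) l + mult (2 * t + 2) l
                 <= k - 1)%N].

Definition C0 (k i : nat) (l : seq nat) : Prop :=
  C1 k i l /\
  forall t : nat,
    (mult (2 * t) l + mult (2 * t + 1) l + mult (2 * t + 2) l = k - 1)%N ->
    (t * mult (2 * t) l + t * mult (2 * t + 1) l + t.+1 * mult (2 * t + 2) l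
     = odd_upto l (2 * t + 1) + i - 1 %[mod 2])%N.

Definition CC (j k i : nat) (l : seq nat) : Prop :=
  if j == 0%N then C0 k i l else C1 k i l.

(** C_j(k, i; m, n).  A partition of n into m parts is an m-tuple whose
    entries are at most n, which makes the set below finite. *)
Definition numC (j k i m n : nat) : nat :=
  #|[set l : m.-tuple 'I_n.+1 |
       let s := [seq val p | p <- l] in
       (sumn s == n) && `[< CC j k i s >]]|.

Definition lhs_term (j k i : nat) (mn : nat * nat) : K :=
  (numC j k i mn.1 mn.2)%:R * x ^+ mn.1 * q ^+ mn.2.

(** The summation index (N_1, ..., N_{k-1}) is a tuple of length k - 1, and
    N_r is its entry of index r - 1, extended by 0 (so N_2 = 0 if k = 2). *)
Definition chain (n : nat) : pred (n.-tuple nat) := fun N => sorted geq N.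
Definition Nr (N : seq nat) (r : nat) : nat := nth 0%N N r.-1.

Definition rhs_term (j k i : nat) (N : (k - 1).-tuple nat) : K :=
  q ^+ (2 * (\sum_(1 <= r < k) Nr N r ^ 2 + \sum_(i <= r < k) Nr N r))
  * qpoch (- q ^ (1 - 2 * (Nr N 2)%:Z)) (q ^+ 2) (Nr N 2)
  * qpoch_inf (- (x * q ^+ (1 + 2 * Nr N 1))) (q ^+ 2)
  * x ^+ (\sum_(1 <= r < k) Nr N r)
  / ((\prod_(1 <= r < k - 1) qpoch (q ^+ 2) (q ^+ 2) (Nr N r - Nr N r.+1))
     * qpoch (q ^+ (4 - 2 * j)) (q ^+ (4 - 2 * j)) (Nr N (k - 1))).

(* Main.v *)
Require Import Defs.
From mathcomp Require Import all_boot all_order all_algebra.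
From mathcomp Require Import boolp.
From mathcomp Require classical_sets.
From mathcomp Require Import ring zify.

(** With p = q^2 and a = -1/q, the multiple sum is the last term of a chain of
    Bailey pairs.  One starts from the unit Bailey pair relative to xp, makes
    one step with parameter b (b = 0 if j = 1, b = -1 if j = 0), then one step
    for each N_r with r >= i relative to xp, changes the base from xp to x,
    makes one step for each N_r with 2 < r < i, a step with parameter a for
    N_2, and lets the last index go to infinity.  This writes the multiple sum
    as a single sum J_i(x).  Regrouping consecutive terms of the single sum
    gives q-difference equations that express J_i(x) by J_1(xp), ..., J_k(xp),
    and removing the parts 1 and 2 from a partition gives the same equations
    for the generating function of the partitions.  These equations determine
    the solution that tends to 1 when x tends to 0.

    All series live in A[[q]], with A = Z[x] in the end; the substitution
    x -> xp is expressed by keeping the argument z of all series variable, and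
    limits are handled by congruences modulo powers of q.  As a is not in
    A[[q]], the parameter called a below is ap = -q. *)

Set Implicit Arguments.
Unset Strict Implicit.
Unset Printing Implicit Defensive.

Import GRing.Theory.
Local Open Scope ring_scope.

(** * q-adic limits of formal power series *)

Section Qadic.
Variable A : idomainType.
Local Notation R := (fps A).
Implicit Types (f g h : R) (u v : nat -> R).

Definition fpsX : R := Fps (fun n => (n == 1)%N%:R).

Lemma fcoefD f g n : fcoef (f + g) n = fcoef f n + fcoef g n.
Proof. by []. Qed.

Lemma fcoef_sum (I : Type) (r : seq I) (P : pred I) (F : I -> R) n :
  fcoef (\sum_(i <- r | P i) F i) n = \sum_(i <- r | P i) fcoef (F i) n.
Proof. exact: (big_morph (fun f => fcoef f n) (fun f g => fcoefD f g n)). Qed.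

Lemma fcoefXM f n : fcoef (fpsX * f) n = if n is m.+1 then fcoef f m else 0.
Proof.
case: n => [|n] /=; first by rewrite big_ord_recl big_ord0 mul0r addr0.
rewrite !big_ord_recl /= mul0r add0r mul1r big1 ?addr0 => [|i _].
  by rewrite /bump subSS subn0.
by rewrite mul0r.
Qed.

Lemma fcoefXnM k f n :
  fcoef (fpsX ^+ k * f) n = if (n < k)%N then 0 else fcoef f (n - k).
Proof.
elim: k n => [|k IHk] n; first by rewrite expr0 mul1r subn0.
rewrite exprS -mulrA fcoefXM; case: n => [//|n].
by rewrite IHk subSS ltnS.
Qed.

Definition dvq n f : Prop := exists h, f = fpsX ^+ n * h.

Lemma dvq_coef n f : dvq n f <-> forall m, (m < n)%N -> fcoef f m = 0.
Proof.
split=> [[h ->] m mn|f0]; first by rewrite fcoefXnM mn.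
exists (Fps (fun m => fcoef f (m + n))); apply: fpsP => m.
by rewrite fcoefXnM; case: ltnP => [/f0 //|nm] /=; rewrite subnK.
Qed.

Lemma dvq0 n : dvq n 0.
Proof. by exists 0; rewrite mulr0. Qed.
Lemma dvq_0 f : dvq 0 f.
Proof. by exists f; rewrite mul1r. Qed.
Lemma dvqD n f g : dvq n f -> dvq n g -> dvq n (f + g).
Proof. by move=> [h ->] [h' ->]; exists (h + h'); rewrite mulrDr. Qed.
Lemma dvqN n f : dvq n f -> dvq n (- f).
Proof. by move=> [h ->]; exists (- h); rewrite mulrN. Qed.
Lemma dvqB n f g : dvq n f -> dvq n g -> dvq n (f - g).
Proof. by move=> hf /dvqN; apply: dvqD. Qed.
Lemma dvq_mulr n f g : dvq n f -> dvq n (f * g).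
Proof. by move=> [h ->]; exists (h * g); rewrite mulrA. Qed.
Lemma dvq_mull n f g : dvq n g -> dvq n (f * g).
Proof. by rewrite mulrC; apply: dvq_mulr. Qed.
Lemma dvqM m n f g : dvq m f -> dvq n g -> dvq (m + n) (f * g).
Proof. by move=> [h ->] [h' ->]; exists (h * h'); rewrite exprD; ring. Qed.
Lemma dvq_le m n f : (m <= n)%N -> dvq n f -> dvq m f.
Proof.
by move=> /subnKC <- [h ->]; rewrite exprD -mulrA; exists (fpsX ^+ (n - m) * h).
Qed.
Lemma dvqX m n f : dvq m f -> dvq (n * m) (f ^+ n).
Proof.
move=> hf; elim: n => [|n IHn]; first exact: dvq_0.
by rewrite exprS mulSn; apply: dvqM.
Qed.
Lemma dvqX1 n f : dvq 1 f -> dvq n (f ^+ n).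
Proof. by move/(dvqX n); rewrite muln1. Qed.
Lemma dvq_sum n (I : eqType) (r : seq I) (P : pred I) (F : I -> R) :
  (forall i, i \in r -> P i -> dvq n (F i)) -> dvq n (\sum_(i <- r | P i) F i).
Proof.
move=> hF; rewrite big_seq_cond.
elim/big_ind: _ => [|f g|i /andP[]]; [exact: dvq0|exact: dvqD|exact: hF].
Qed.
Lemma dvq_sum_nat n a b (F : nat -> R) :
  (forall i, (a <= i < b)%N -> dvq n (F i)) -> dvq n (\sum_(a <= i < b) F i).
Proof. by move=> hF; apply: dvq_sum => i; rewrite mem_index_iota => /hF. Qed.

Lemma dvq_eq0 f : (forall n, dvq n f) -> f = 0.
Proof. by move=> hf; apply: fpsP => n; apply: (dvq_coef _ _).1 (hf n.+1) _ _. Qed.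
Lemma dvq_eq f g : (forall n, dvq n (f - g)) -> f = g.
Proof. by move/dvq_eq0/eqP; rewrite subr_eq0 => /eqP. Qed.

Lemma dvq_trans n f g h : dvq n (f - g) -> dvq n (g - h) -> dvq n (f - h).
Proof. by move=> h1 h2; rewrite -(subrKA g); apply: dvqD. Qed.
Lemma dvq_sym n f g : dvq n (f - g) -> dvq n (g - f).
Proof. by move/dvqN; rewrite opprB. Qed.

Lemma dvqn1_neq0 f : dvq 1 f -> f <> 1.
Proof.
move=> /(dvq_coef _ _).1 /(_ 0 isT) f0 f1.
by move/eqP: f0; rewrite f1 /= oner_eq0.
Qed.

(* The q-adic limit of u, if u n and u n.+1 are congruent modulo q^n for all n. *)
Definition adlim u : R := Fps (fun n => fcoef (u n.+1) n).

Lemma adlimP u : (forall n, dvq n (u n.+1 - u n)) ->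
  forall n, dvq n (adlim u - u n).
Proof.
move=> hu n; apply/dvq_coef => m mn /=.
suff -> : fcoef (u n) m = fcoef (u m.+1) m by rewrite subrr.
rewrite -(subnKC mn); elim: (n - _)%N => [|d IHd]; first by rewrite addn0.
apply/eqP; rewrite -IHd addnS -subr_eq0; apply/eqP.
by apply: (dvq_coef _ _).1 (hu _) _ _; lia.
Qed.

(** This explicit rate makes the partial sums meet the condition of [adlim], and it survives
    multiplication by arbitrary factors. *)
Definition summable u := forall n, dvq n (u n).
Definition qsum u : R := adlim (fun n => \sum_(0 <= i < n) u i).

Lemma qsumP u : summable u -> forall n, dvq n (qsum u - \sum_(0 <= i < n) u i).
Proof. by move=> hu; apply: adlimP => n; rewrite /= big_nat_recr //= addrAC subrr add0r. Qed.

Lemma qsum_uniq u s : summable u ->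
  (forall n, dvq n (s - \sum_(0 <= i < n) u i)) -> qsum u = s.
Proof.
move=> hu hs; apply: dvq_eq => n.
by apply: dvq_trans (qsumP hu n) _; apply: dvq_sym.
Qed.

Lemma eq_qsum u v : u =1 v -> qsum u = qsum v.
Proof.
by move=> uv; apply: fpsP => n /=; rewrite !fcoef_sum; under eq_bigr do rewrite uv.
Qed.

Lemma summableMr u v : summable u -> summable (fun n => u n * v n).
Proof. by move=> hu n; apply: dvq_mulr. Qed.
Lemma summableMl u v : summable v -> summable (fun n => u n * v n).
Proof. by move=> hu n; apply: dvq_mull. Qed.
Lemma summableS u : summable u -> summable (fun n => u n.+1).
Proof. by move=> hu n; apply: dvq_le (hu _). Qed.

Lemma qsumD u v : summable u -> summable v ->
  qsum (fun n => u n + v n) = qsum u + qsum v.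
Proof.
move=> hu hv; apply: qsum_uniq => [n|n]; first exact: dvqD.
rewrite big_split /= opprD addrACA; apply: dvqD; exact: qsumP.
Qed.

Lemma qsumZ c u : summable u -> qsum (fun n => c * u n) = c * qsum u.
Proof.
move=> hu; apply: qsum_uniq => [n|n]; first exact: dvq_mull.
by rewrite -mulr_sumr -mulrBr; apply/dvq_mull/qsumP.
Qed.

Lemma qsumN u : summable u -> qsum (fun n => - u n) = - qsum u.
Proof.
move=> hu; rewrite -mulN1r -qsumZ //; apply: eq_qsum => n.
by rewrite mulN1r.
Qed.

Lemma qsumB u v : summable u -> summable v ->
  qsum (fun n => u n - v n) = qsum u - qsum v.
Proof. by move=> hu hv; rewrite -qsumN // -qsumD // => n; apply: dvqN. Qed.

Lemma qsum_recl u : summable u -> qsum u = u 0%N + qsum (fun n => u n.+1).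
Proof.
move=> hu; apply: qsum_uniq => // n.
have -> : \sum_(0 <= i < n) u i = u 0%N + \sum_(0 <= i < n) u i.+1 - u n.
  by rewrite -big_nat_recl // big_nat_recr //= addrK.
rewrite (_ : _ - _ = u n + (qsum (fun n => u n.+1) - \sum_(0 <= i < n) u i.+1)); last by ring.
apply: dvqD => //.
exact: qsumP (summableS hu) n.
Qed.

Lemma dvq_qsum m u : summable u -> (forall n, dvq m (u n)) -> dvq m (qsum u).
Proof.
move=> hu hm; rewrite -[qsum u](subrK (\sum_(0 <= i < m) u i)).
by apply: dvqD; [apply: qsumP|apply: dvq_sum_nat].
Qed.

Lemma qsum0 u : (forall n, u n = 0) -> qsum u = 0.
Proof.
move=> u0; apply: qsum_uniq => [n|n]; first by rewrite u0; apply: dvq0.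
by rewrite big1 ?subrr; [apply: dvq0|].
Qed.

Lemma triangle_sum (V : nmodType) (G : nat -> nat -> V) L :
  \sum_(0 <= r < L.+1) \sum_(0 <= s < r.+1) G s (r - s)%N
  = \sum_(0 <= s < L.+1) \sum_(0 <= n < (L - s).+1) G s n.
Proof.
elim: L => [|L IHL]; first by rewrite !big_nat1.
rewrite big_nat_recr //= {}IHL [RHS]big_nat_recr //= subnn big_nat1.
rewrite [X in _ + X]big_nat_recr //= subnn addrA; congr (_ + _).
rewrite -big_split /=; apply: eq_big_nat => s /andP[_ sL].
by rewrite subSn -1?ltnS // [in RHS]big_nat_recr.
Qed.

(** Modulo q^(N+1) both sides reduce to the terms with s + n <= N. *)
Lemma qsum_exch (G : nat -> nat -> R) :
  (forall s n, dvq (s + n) (G s n)) ->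
  qsum (fun N => \sum_(0 <= s < N.+1) G s (N - s)%N)
  = qsum (fun s => qsum (G s)).
Proof.
move=> hG.
have sG s : summable (G s) by move=> n; apply: dvq_le (hG s n); apply: leq_addl.
have sq : summable (fun s => qsum (G s)).
  by move=> s; apply: dvq_qsum => // n; apply: dvq_le (hG s n); apply: leq_addr.
apply: qsum_uniq => [N|[|N]].
- apply: dvq_sum_nat => s /andP[_ sN].
  by apply: dvq_le (hG _ _); rewrite subnKC.
- exact: dvq_0.
apply: dvq_trans (qsumP sq N.+1) _.
rewrite (triangle_sum G) -sumrB; apply: dvq_sum_nat => s /andP[_ sN].
apply: dvq_trans (qsumP (sG s) N.+1) _.
rewrite (@big_cat_nat _ _ _ (N - s).+1 0 N.+1) //=; last by rewrite ltnS leq_subr.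
rewrite addrAC subrr add0r; apply: dvq_sum_nat => n /andP[ns _].
by apply: dvq_le (hG s n); lia.
Qed.

(** The inverse is the geometric series in 1 - f. *)
Lemma dvq1_unit f : dvq 1 (f - 1) -> f \is a GRing.unit.
Proof.
move=> hf; have sg : summable (fun n => (1 - f) ^+ n).
  by move=> n; apply/dvqX1/dvq_sym.
apply/unitrPr; exists (qsum (fun n => (1 - f) ^+ n)).
have {1}-> : f = 1 - (1 - f) by rewrite subKr.
rewrite mulrBl mul1r -qsumZ // [X in X - _]qsum_recl // expr0.
rewrite (@eq_qsum (fun n => (1 - f) ^+ n.+1) (fun n => (1 - f) * (1 - f) ^+ n)) ?addrK //.
by move=> n; rewrite exprS.
Qed.

End Qadic.

(** * q-Pochhammer symbols *)

Section Pochhammer.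
Variable A : idomainType.
Local Notation R := (fps A).
Variable p : R.
Hypothesis p_dvq : dvq 1 p.
Implicit Types (a b c z : R).

Definition poch c n : R := \prod_(0 <= t < n) (1 - c * p ^+ t).
Definition invpoch n : R := (poch p n)^-1.
Definition pochinf c : R := adlim (poch c).
(* In the notation of the paper, w z (z * (p * a)) n is
   z^n p^(n^2) (a p^(1-n); p)_n, here without negative powers of p; in
   particular w z 0 n is z^n p^(n^2). *)
Definition w z b n : R := \prod_(0 <= t < n) (p ^+ t * (z * p ^+ t.+1 - b)).

Lemma poch0 c : poch c 0 = 1.
Proof. by rewrite /poch big_nil. Qed.
Lemma pochSr c n : poch c n.+1 = poch c n * (1 - c * p ^+ n).
Proof. by rewrite /poch big_nat_recr. Qed.
Lemma pochSl c n : poch c n.+1 = (1 - c) * poch (c * p) n.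
Proof.
rewrite /poch big_nat_recl //= expr0 mulr1; congr (_ * _).
by apply: eq_bigr => t _; rewrite exprS mulrA.
Qed.
Lemma poch_add c m n : poch c (m + n) = poch c m * poch (c * p ^+ m) n.
Proof.
elim: n => [|n IHn]; first by rewrite addn0 poch0 mulr1.
by rewrite addnS !pochSr IHn exprD !mulrA.
Qed.
Lemma poch_zero n : poch 0 n = 1.
Proof. by rewrite /poch big1 // => t _; rewrite mul0r subr0. Qed.

Lemma w0 z b : w z b 0 = 1.
Proof. by rewrite /w big_nil. Qed.
Lemma wSr z b n : w z b n.+1 = w z b n * (p ^+ n * (z * p ^+ n.+1 - b)).
Proof. by rewrite /w big_nat_recr. Qed.

Lemma w_add z b s n :
  w z b (s + n) = w z b s * w (z * p ^+ s.*2) (b * p ^+ s) n.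
Proof.
elim: n => [|n IHn]; first by rewrite addn0 w0 mulr1.
rewrite addnS !wSr IHn -mulrA; congr (_ * _); congr (_ * _).
by rewrite -addnn !exprS !exprD; ring.
Qed.

Lemma wSl z b n : w z b n.+1 = p ^+ n * (z * p - b) * w (z * p) b n.
Proof.
elim: n => [|n IHn]; first by rewrite wSr !w0 expr0 expr1; ring.
rewrite wSr IHn wSr !exprS; ring.
Qed.

Lemma w_scale c b z n : w (c * z) (c * b) n = c ^+ n * w z b n.
Proof.
elim: n => [|n IHn]; first by rewrite !w0 mulr1.
by rewrite !wSr IHn !exprS; ring.
Qed.

Lemma dvq_pX n : dvq n (p ^+ n).
Proof. exact: dvqX1. Qed.

Lemma dvq_zpX z n : dvq n (z * p ^+ n).
Proof. exact/dvq_mull/dvq_pX. Qed.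

Lemma w_summable z b : dvq 1 b -> summable (w z b).
Proof.
move=> hb; elim=> [|n IHn]; first exact: dvq_0.
rewrite wSr -addn1; apply: dvqM => //; apply: dvq_mull; apply: dvqB => //.
by apply: dvq_mull; rewrite addn1 exprS; apply: dvq_mulr.
Qed.

Lemma dvq_poch m c n : dvq m c -> dvq m (poch c n - 1).
Proof.
move=> hc; elim: n => [|n IHn]; first by rewrite poch0 subrr; apply: dvq0.
rewrite pochSr mulrBr mulr1 addrAC; apply: dvqB => //.
by apply/dvq_mull/dvq_mulr.
Qed.

Lemma poch_unit c n : dvq 1 c -> poch c n \is a GRing.unit.
Proof. by move=> hc; apply/dvq1_unit/dvq_poch. Qed.

Lemma onemX_unit n : 1 - p ^+ n.+1 \is a GRing.unit.
Proof.
apply: dvq1_unit; rewrite addrAC subrr add0r; apply: dvqN.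
by rewrite exprS; apply: dvq_mulr.
Qed.

Lemma invpoch0 : invpoch 0 = 1.
Proof. by rewrite /invpoch poch0 invr1. Qed.

Lemma invpochS n : invpoch n = invpoch n.+1 * (1 - p ^+ n.+1).
Proof.
rewrite /invpoch pochSr -exprS invrM ?poch_unit ?onemX_unit //.
by rewrite mulrAC mulVr ?mul1r ?onemX_unit.
Qed.

Lemma invpoch_subS n r : (r <= n)%N ->
  invpoch (n - r) = invpoch (n.+1 - r) * (1 - p ^+ (n.+1 - r)).
Proof. by move=> rn; rewrite subSn // -invpochS. Qed.

Lemma pochinfP c n : dvq n (pochinf c - poch c n).
Proof.
move: n; apply: adlimP => n; rewrite pochSr mulrBr mulr1 addrAC subrr add0r.
by apply/dvqN/dvq_mull/dvq_zpX.
Qed.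

Lemma pochinfS c : pochinf c = (1 - c) * pochinf (c * p).
Proof.
apply: dvq_eq => n; apply: (@dvq_trans _ _ _ (poch c n.+1)).
  exact: dvq_le (leqnSn n) (pochinfP _ _).
by rewrite pochSl -mulrBr; apply/dvq_mull/dvq_sym/pochinfP.
Qed.

Lemma pochinfSX c n : pochinf (c * p ^+ n) = (1 - c * p ^+ n) * pochinf (c * p ^+ n.+1).
Proof. by rewrite pochinfS -mulrA -exprSr. Qed.

Lemma pochinf_split c n : pochinf c = poch c n * pochinf (c * p ^+ n).
Proof.
elim: n => [|n IHn]; first by rewrite poch0 mul1r mulr1.
by rewrite IHn pochSr pochinfS exprSr !mulrA.
Qed.

Lemma dvq_pochinf m c : dvq m c -> dvq m (pochinf c - 1).
Proof. by move=> hc; apply: dvq_trans (pochinfP c m) (dvq_poch _ hc). Qed.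

Lemma pochinf_unit c : dvq 1 c -> pochinf c \is a GRing.unit.
Proof. by move=> hc; apply/dvq1_unit/dvq_pochinf. Qed.

(* The q-Chu-Vandermonde sum; the induction step splits
   1 - p^(N+1) = (1 - p^(N+1-n)) + p^(N+1-n) (1 - p^n). *)
Lemma chu_vandermonde N z b :
  \sum_(0 <= n < N.+1)
     w z b n * invpoch n * invpoch (N - n) * poch (z * p ^+ n.+1) (N - n)
  = poch b N * invpoch N.
Proof.
elim: N z => [|N IHN] z.
  by rewrite big_nat1 w0 invpoch0 !poch0 !mulr1.
apply: (mulrI (onemX_unit N)).
have -> : (1 - p ^+ N.+1) * (poch b N.+1 * invpoch N.+1)
   = (1 - z * p ^+ N.+1) * (poch b N * invpoch N)
     + p ^+ N * (z * p - b) * (poch b N * invpoch N).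
  by rewrite (invpochS N) pochSr exprS; ring.
(* The two parts are expanded by the induction hypothesis at different bases, z and z p; the second
   matches [G] because [wSl] passes from z to z p. *)
rewrite -{1}(IHN z) -(IHN (z * p)) !mulr_sumr.
pose F n := (1 - p ^+ (N.+1 - n)) * (w z b n * invpoch n * invpoch (N.+1 - n)
               * poch (z * p ^+ n.+1) (N.+1 - n)).
pose G n := p ^+ (N.+1 - n) * (1 - p ^+ n) * (w z b n * invpoch n * invpoch (N.+1 - n)
               * poch (z * p ^+ n.+1) (N.+1 - n)).
transitivity (\sum_(0 <= n < N.+2) F n + \sum_(0 <= n < N.+2) G n).
  rewrite -big_split /=; apply: eq_big_nat => n /andP[_ nN].
  by rewrite /F /G -{1}(subnK (nN : (n <= N.+1)%N)) exprD; ring.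
congr (_ + _).
  rewrite big_nat_recr //= {2}/F subnn subrr mul0r addr0.
  apply: eq_big_nat => n /andP[_ nN].
  have -> : p ^+ N.+1 = p ^+ n.+1 * p ^+ (N - n).
    by rewrite -exprD addSn subnKC.
  rewrite /F (invpoch_subS (nN : (n <= N)%N)) subSn // pochSr; ring.
rewrite big_nat_recl //= {1}/G expr0 subrr mulr0 mul0r add0r.
apply: eq_big_nat => n /andP[_ nN].
have -> : p ^+ N = p ^+ n * p ^+ (N - n) by rewrite -exprD subnKC.
have e2 : z * p ^+ n.+2 = z * p * p ^+ n.+1 by rewrite exprS mulrA.
by rewrite /G subSS (invpochS n) wSl e2; ring.
Qed.

(** This is the q-Chu-Vandermonde sum for N = L - s, z p^(2s) and b p^s; the infinite products share
    the tail from z p^(L+s+1) on, which leaves finite ones. *)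
Lemma chu_vandermonde_pochinf z b s L : (s <= L)%N ->
  \sum_(0 <= n < (L - s).+1)
     w z b (s + n) * invpoch (L - (s + n)) * invpoch n * pochinf (z * p ^+ ((s + n) + s).+1)
  = w z b s * poch (b * p ^+ s) (L - s) * invpoch (L - s) * pochinf (z * p ^+ (L + s).+1).
Proof.
move=> sL; rewrite -2![in RHS]mulrA [poch _ _ * _]mulrA -(chu_vandermonde _ (z * p ^+ s.*2)).
rewrite mulr_suml mulr_sumr; apply: eq_big_nat => n /andP[_ nL].
rewrite w_add subnDA (pochinf_split (z * p ^+ (s + n + s).+1) (L - s - n)).
have -> : z * p ^+ (s + n + s).+1 = z * p ^+ s.*2 * p ^+ n.+1.
  by rewrite -mulrA -exprD; congr (_ * _ ^+ _); lia.
have -> : z * p ^+ s.*2 * p ^+ n.+1 * p ^+ (L - s - n) = z * p ^+ (L + s).+1.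
  by rewrite -!mulrA -!exprD; congr (_ * _ ^+ _); lia.
ring.
Qed.

End Pochhammer.

(** * Bailey pairs *)

Section Bailey.
Variable A : idomainType.
Local Notation R := (fps A).
Variable p : R.
Hypothesis p_dvq : dvq 1 p.
Local Notation poch := (poch p).
Local Notation invpoch := (invpoch p).
Local Notation pochinf := (pochinf p).
Local Notation w := (w p).
Implicit Types (b c z Z : R) (al be ga : nat -> R).

(* A Bailey pair relative to c, with both sides multiplied by Z = (cp;p)_oo so
   that no denominator contains c; when c changes along the chain, Z is kept. *)
Definition bailey Z c al be := forall L,
  Z * be L = \sum_(0 <= r < L.+1) al r * invpoch (L - r) * pochinf (c * p ^+ (L + r).+1).

Lemma eq_bailey Z c al al' be be' : al =1 al' -> be =1 be' ->
  bailey Z c al be -> bailey Z c al' be'.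
Proof.
move=> ea eb h L; rewrite -eb h; apply: eq_bigr => r _; by rewrite ea.
Qed.

(** The Bailey lemma with one parameter c p / b and the other sent to infinity, multiplied by
    (b;p)_L to clear denominators. Expanding [be] and exchanging the sums leaves a q-Chu-Vandermonde
    sum inside. *)
Lemma bailey_step Z c b al be : bailey Z c al be -> forall L,
  Z * \sum_(0 <= r < L.+1) w c b r * invpoch (L - r) * be r
  = \sum_(0 <= s < L.+1) w c b s * al s
      * (poch (b * p ^+ s) (L - s) * invpoch (L - s) * pochinf (c * p ^+ (L + s).+1)).
Proof.
move=> h L.
pose G s n := al s * (w c b (s + n) * invpoch (L - (s + n)) * invpoch n
                      * pochinf (c * p ^+ (s + n + s).+1)).
transitivity (\sum_(0 <= s < L.+1) \sum_(0 <= n < (L - s).+1) G s n).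
  rewrite -triangle_sum mulr_sumr; apply: eq_big_nat => r _.
  rewrite mulrCA h mulr_sumr; apply: eq_big_nat => s /andP[_ sr].
  by rewrite /G subnKC //; ring.
apply: eq_big_nat => s /andP[_ sL].
by rewrite -mulr_sumr chu_vandermonde_pochinf // -?ltnS //; ring.
Qed.

Lemma bailey_step0 Z c al be : bailey Z c al be ->
  bailey Z c (fun s => w c 0 s * al s)
    (fun L => \sum_(0 <= r < L.+1) w c 0 r * invpoch (L - r) * be r).
Proof.
move=> h L; rewrite (bailey_step 0 h); apply: eq_bigr => s _.
by rewrite mul0r poch_zero mul1r mulrA.
Qed.

(** This is (-1)^n p^(n(n-1)/2) (c;p)_n / (p;p)_n. The unit pair has the further factor (1 - c
    p^(2n)) / (1 - c); its numerator is kept apart for the change of base, its denominator is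
    absorbed by taking Z = (c;p)_oo. *)
Definition unit_alpha c n : R := (\prod_(0 <= t < n) (- p ^+ t * (1 - c * p ^+ t))) * invpoch n.

Lemma unit_alphaS c n :
  unit_alpha c n.+1 * (1 - p ^+ n.+1) = - p ^+ n * (1 - c * p ^+ n) * unit_alpha c n.
Proof. by rewrite /unit_alpha big_nat_recr //= (invpochS p_dvq n); ring. Qed.

Lemma unit_alpha0 c : unit_alpha c 0 = 1.
Proof. by rewrite /unit_alpha big_nil invpoch0 mulr1. Qed.

(* The sum telescopes. *)
Lemma bailey_unit c :
  bailey (pochinf c) c (fun r => unit_alpha c r * (1 - c * p ^+ r.*2))
    (fun L => (L == 0)%N%:R).
Proof.
case=> [|L].
  by rewrite big_nat1 unit_alpha0 invpoch0 (pochinfS p_dvq) expr0 expr1 /= mulr1n; ring.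
rewrite mulr0; apply/esym/(mulrI (onemX_unit p_dvq L)); rewrite mulr0.
have part r : (r <= L.+1)%N -> (1 - p ^+ L.+1) *
  \sum_(0 <= i < r) unit_alpha c i * (1 - c * p ^+ i.*2) * invpoch (L.+1 - i)
                    * pochinf (c * p ^+ (L.+1 + i).+1)
  = - (unit_alpha c r * (1 - p ^+ r) * invpoch (L.+1 - r) * pochinf (c * p ^+ (L.+1 + r))).
  elim: r => [|r IHr] rL; first by rewrite big_nil expr0; ring.
  rewrite big_nat_recr //= mulrDr IHr 1?ltnW // unit_alphaS subSS.
  rewrite (invpoch_subS p_dvq (rL : (r <= L)%N)) (pochinfSX p_dvq c (L.+1 + r)) addnS.
  have -> : p ^+ L.+1 = p ^+ (L.+1 - r) * p ^+ r by rewrite -exprD subnK // ltnW.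
  have -> : p ^+ (L.+1 + r) = p ^+ (L.+1 - r) * p ^+ r * p ^+ r.
    by rewrite exprD -{1}(subnK (ltnW rL)) exprD.
  by rewrite -addnn exprD; set e := pochinf _; ring.
rewrite big_nat_recr //= mulrDr part // subnn invpoch0 (pochinfSX p_dvq c (L.+1 + _)).
by rewrite addnn; ring.
Qed.

(** In a step applied to the unit pair only r = 0 survives on the left, which gives 1/(p;p)_L; then
    both sides are divided by (b;p)_L. *)
Lemma bailey_start c b : dvq 1 b ->
  bailey (pochinf c) c
    (fun r => w c b r * (poch b r)^-1 * unit_alpha c r * (1 - c * p ^+ r.*2))
    (fun L => invpoch L * (poch b L)^-1).
Proof.
move=> hb L; have := bailey_step b (bailey_unit c) L.
rewrite big_nat_recl //= [X in _ + X]big1 => [|r _]; last by rewrite mulr0.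
rewrite w0 subn0 mul1r mulr1 addr0 => h.
rewrite mulrA h mulr_suml; apply: eq_big_nat => s /andP[_ sL].
have -> : (poch b s)^-1 = poch (b * p ^+ s) (L - s) * (poch b L)^-1.
  have us : poch b s \is a GRing.unit by apply: poch_unit.
  have uL : poch b L \is a GRing.unit by apply: poch_unit.
  apply: (mulrI us); rewrite mulrV // mulrA -poch_add subnKC ?mulrV //.
ring.
Qed.

(** The change of base rests on 1 - z p^(2r+1) = (1 - z p^(L+r+1)) - z p^(2r+1) (1 - p^(L-r)): the
    first part completes the infinite product for the base z, the second moves to the index r +
    1. *)
Lemma bailey_conv Z z ga be :
  bailey Z (z * p) (fun r => ga r * (1 - z * p ^+ r.*2.+1)) be ->
  bailey Z z
    (fun r => ga r - (if r is s.+1 then z * p ^+ s.*2.+1 * ga s else 0)) be.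
Proof.
move=> h L; rewrite h big_nat_recr //=.
under [RHS]eq_bigr do rewrite !mulrBl.
rewrite sumrB big_nat_recr //= [X in _ = _ - X]big_nat_recl // !mul0r add0r.
rewrite -[z * p * p ^+ (L + L).+1]mulrA -exprS addrAC -sumrB subnn invpoch0.
congr (_ + _).
  apply: eq_big_nat => r /andP[_ rL].
  rewrite -[z * p * _]mulrA -exprS (pochinfSX p_dvq z (L + r).+1).
  have -> : invpoch (L - r.+1) = invpoch (L - r) * (1 - p ^+ (L - r)).
    by rewrite subnS; case: (L - r)%N (subn_gt0 r L) => [|n _] /=;
      rewrite ?rL // -invpochS.
  rewrite addnS.
  have -> : p ^+ (L + r).+1 = p ^+ (L - r) * p ^+ r.*2.+1.
    by rewrite -exprD; congr (_ ^+ _); lia.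
  set e := pochinf _; ring.
rewrite (pochinfSX p_dvq z (L + L).+1) addnn.
by set e := pochinf _; ring.
Qed.

Let cauchy_term c n := w c 0 n * invpoch n * pochinf (c * p ^+ n.+1).

Let cauchy_summable c : summable (cauchy_term c).
Proof. by apply/summableMr/summableMr/w_summable/dvq0. Qed.

Lemma w0_scale c n : w (c * p) 0 n = p ^+ n * w c 0 n.
Proof. by rewrite mulrC -w_scale mulr0. Qed.

Lemma w0S c n : w c 0 n.+1 = c * p * w (c * p ^+ 2) 0 n.
Proof. by rewrite wSl (_ : c * p ^+ 2 = c * p * p) ?w0_scale; ring. Qed.

(** Splitting the Pochhammer factor produces a sum whose terms contain 1 - p^n; it has no term at 0,
    and shifting its index gives c p times the sum at c p^2. *)
Let cauchy_rec c :
  qsum (cauchy_term c) - qsum (cauchy_term (c * p))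
  = - (c * p) * (qsum (cauchy_term (c * p)) - qsum (cauchy_term (c * p * p))).
Proof.
have sc := cauchy_summable.
pose u n := w c 0 n * invpoch n * (1 - p ^+ n) * pochinf (c * p ^+ n.+2).
have su : summable u by apply/summableMr/summableMr/summableMr/w_summable/dvq0.
have -> : qsum (cauchy_term c) - qsum (cauchy_term (c * p))
          = qsum u - c * p * qsum (cauchy_term (c * p)).
  have sc' : summable (fun n => c * p * cauchy_term (c * p) n) by apply: summableMl.
  rewrite -qsumB // -qsumZ // -qsumB //.
  apply: eq_qsum => n; rewrite /cauchy_term /u (pochinfSX p_dvq c n.+1).
  rewrite w0_scale -[c * p * p ^+ _]mulrA -exprS; set e := pochinf _.
  by rewrite !exprS; ring.
rewrite qsum_recl // {1}/u expr0 subrr mulr0 mul0r add0r.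
rewrite (@eq_qsum _ _ (fun n => c * p * cauchy_term (c * p * p) n)).
  by rewrite qsumZ //; ring.
move=> n; rewrite /cauchy_term /u (invpochS p_dvq n) w0S.
by rewrite -![c * p * p]mulrA -expr2 -[c * _ * p ^+ _]mulrA -exprD; ring.
Qed.

(** Cauchy's sum of c^n p^(n^2) / ((p;p)_n (cp;p)_n), multiplied by (cp;p)_oo. Iterating
    [cauchy_rec] shows that the values at c and c p agree modulo every power of q; then c may be
    replaced by c p^T, which tends to 0. *)
Lemma cauchy c : qsum (fun n => w c 0 n * invpoch n * pochinf (c * p ^+ n.+1)) = 1.
Proof.
have sc := cauchy_summable.
have inv c' : qsum (cauchy_term c') = qsum (cauchy_term (c' * p)).
  apply: dvq_eq => T; elim: T c' => [|T IHT] c'; first exact: dvq_0.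
  rewrite cauchy_rec -add1n; apply: dvqM => //.
  by apply/dvqN/dvq_mull.
have inv' T : qsum (cauchy_term c) = qsum (cauchy_term (c * p ^+ T)).
  elim: T => [|T ->]; first by rewrite mulr1.
  by rewrite inv exprSr mulrA.
apply: dvq_eq => T; rewrite [X in X - _](inv' T) qsum_recl //.
rewrite {1}/cauchy_term w0 invpoch0 !mul1r addrAC; apply: dvqD.
  by apply/dvq_pochinf/dvq_mulr/dvq_zpX.
apply: dvq_qsum => [|n]; first exact: summableS.
by rewrite /cauchy_term w0S -!mulrA mulrA; apply/dvq_mulr/dvq_zpX.
Qed.

(** Writing 1 = (1 - c p^(n+1)) + c p^(n+1) splits the sum into Cauchy's sums at c and c p. *)
Lemma cauchy' c : qsum (fun n => w c 0 n * invpoch n * pochinf (c * p ^+ n.+2)) = 1 + c * p.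
Proof.
have s2 : summable (fun n => w c 0 n * invpoch n * pochinf (c * p ^+ n.+2)).
  by apply/summableMr/summableMr/w_summable/dvq0.
rewrite -(cauchy c) -[c * p in RHS]mulr1 -(cauchy (c * p)).
rewrite -qsumZ; last exact: cauchy_summable.
rewrite -qsumD; [|exact: cauchy_summable|by move=> n; apply/dvq_mull/cauchy_summable].
apply: eq_qsum => n; rewrite (pochinfSX p_dvq c n.+1) w0_scale.
rewrite -[c * p * p ^+ _]mulrA -exprS; set e := pochinf _.
by rewrite !exprS; ring.
Qed.

End Bailey.

(** * The multiple sum as a single sum *)

Section MultiSum.
Variable A : idomainType.
Local Notation R := (fps A).
Variables p a b : R.
Hypothesis p_dvq : dvq 1 p.
Local Notation poch := (poch p).
Local Notation invpoch := (invpoch p).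
Local Notation pochinf := (pochinf p).
Local Notation w := (w p).
Local Notation unit_alpha := (unit_alpha p).
Local Notation bailey := (bailey p).
Implicit Types (z Z : R) (al be ga : nat -> R).

Let bp_dvq : dvq 1 (b * p). Proof. exact: dvq_mull. Qed.
Let w0_summable z : summable (w z 0). Proof. exact/w_summable/dvq0. Qed.

(* The sum over N_r >= ... >= N_{r+len-1} of the multiple sum, for N_{r-1} = L.
   Replacing z by z p for r >= i accounts for the exponents N_i + ... + N_{k-1}. *)
Fixpoint nest i z r len L : R :=
  if len is l.+1 then
    \sum_(0 <= s < L.+1)
      w (if (i <= r)%N then z * p else z)
        (if r == 2 then (if (i <= r)%N then z * p else z) * a else 0) s
      * invpoch (L - s) * nest i z r.+1 l s
  else invpoch L * (poch (b * p) L)^-1.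

Lemma nestS i z r l L : nest i z r l.+1 L =
  \sum_(0 <= s < L.+1)
      w (if (i <= r)%N then z * p else z)
        (if r == 2 then (if (i <= r)%N then z * p else z) * a else 0) s
      * invpoch (L - s) * nest i z r.+1 l s.
Proof. by []. Qed.

(** The sum over N_1, where the last index has gone to infinity. For p = q^2, a = -q and z = x the
    infinite product is (-x q^(1+2N_1); q^2)_oo. *)
Definition multisum k i z : R :=
  qsum (fun N => w z 0 N * pochinf (a * z * p ^+ N) * nest i z 2 (k - 2) N).

Definition start_alpha z n : R :=
  w (z * p) (b * p) n * (poch (b * p) n)^-1 * unit_alpha (z * p) n.

(** For r >= i the starting pair with parameter b p is followed by [len] plain steps, all relative
    to z p. *)
Lemma nest_bailey_hi i z r len : (i <= r)%N -> (2 < r)%N ->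
  bailey (pochinf (z * p)) (z * p)
    (fun s => w (z * p) 0 s ^+ len * start_alpha z s * (1 - z * p ^+ s.*2.+1))
    (nest i z r len).
Proof.
move=> ir r2; elim: len r ir r2 => [|len IHl] r ir r2.
  apply: eq_bailey (bailey_start p_dvq (z * p) bp_dvq) => s //.
  by rewrite /start_alpha exprS; ring.
apply: eq_bailey (bailey_step0 p_dvq (IHl r.+1 (ltnW _) (ltnW _))) => // s.
  by rewrite [_ ^+ len.+1]exprS; ring.
by rewrite nestS ir gtn_eqF.
Qed.

(** Induction on the number d of steps made after the change of base, which takes place at r = i. *)
Lemma nest_bailey_lo i z r d len : (r + d = i)%N -> (2 < r)%N ->
  bailey (pochinf (z * p)) z
    (fun s => w z 0 s ^+ d *
       (w (z * p) 0 s ^+ len * start_alpha z s -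
        if s is s'.+1 then
          z * p ^+ s'.*2.+1 * (w (z * p) 0 s' ^+ len * start_alpha z s') else 0))
    (nest i z r (d + len)).
Proof.
move=> rdi r2; elim: d r rdi r2 => [|d IHd] r rdi r2.
  rewrite addn0 in rdi.
  apply: eq_bailey (bailey_conv p_dvq (nest_bailey_hi z len (eq_leq (esym rdi)) r2)) => // s.
  by rewrite expr0 mul1r.
have rdi' : (r.+1 + d = i)%N by rewrite -addSnnS in rdi.
apply: eq_bailey (bailey_step0 p_dvq (IHd _ rdi' (ltnW r2))) => // s.
  by rewrite [_ ^+ d.+1]exprS; ring.
by rewrite nestS gtn_eqF // leqNgt -rdi' addSn ltnS leq_addr.
Qed.

(** After the step with parameter a the sums are exchanged; the inner sum over N is Cauchy's,
    relative to z p^(2s). *)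
Lemma bailey_last Z z al be : bailey Z z al be ->
  Z * qsum (fun N => w z 0 N * pochinf (a * z * p ^+ N) *
        \sum_(0 <= s < N.+1) w z (z * a) s * invpoch (N - s) * be s)
  = qsum (fun s => w z 0 s * w z (z * a) s * al s * pochinf (a * z * p ^+ s)).
Proof.
move=> h; rewrite -qsumZ; last exact/summableMr/summableMr.
pose G s n := w z (z * a) s * al s * pochinf (a * z * p ^+ s)
              * (w z 0 (s + n) * invpoch n * pochinf (z * p ^+ (s + n + s).+1)).
rewrite (@eq_qsum _ _ (fun N => \sum_(0 <= s < N.+1) G s (N - s)%N)); last first.
  move=> N; rewrite mulrCA (bailey_step p_dvq _ h) mulr_sumr.
  apply: eq_big_nat => s /andP[_ sN]; rewrite /G subnKC //.
  rewrite (pochinf_split p_dvq (a * z * p ^+ s) (N - s)) (mulrC z a).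
  have -> : a * z * p ^+ s * p ^+ (N - s) = a * z * p ^+ N.
    by rewrite -mulrA -exprD subnKC.
  ring.
rewrite qsum_exch => [|s n]; last exact/dvq_mull/dvq_mulr/dvq_mulr/w0_summable.
apply: eq_qsum => s; rewrite /G.
rewrite (@eq_qsum _ _ (fun n => w z (z * a) s * al s * pochinf (a * z * p ^+ s) * w z 0 s *
   (w (z * p ^+ s.*2) 0 n * invpoch n * pochinf (z * p ^+ s.*2 * p ^+ n.+1)))); last first.
  move=> n; rewrite w_add mul0r -[z * _ * p ^+ n.+1]mulrA -exprD.
  by rewrite (_ : (s.*2 + n.+1)%N = (s + n + s).+1); [ring|lia].
by rewrite qsumZ ?cauchy //; [ring|apply/summableMr/summableMr].
Qed.

(** The case i = 2: the step with parameter a is relative to z p but the outer sum to z. The inner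
    sum then splits into a [cauchy'] sum and a [cauchy] sum, which replaces the change of base. *)
Lemma bailey_last_shift Z z al be : bailey Z (z * p) al be ->
  Z * qsum (fun N => w z 0 N * pochinf (a * z * p ^+ N) *
        \sum_(0 <= s < N.+1) w (z * p) (z * p * a) s * invpoch (N - s) * be s)
  = qsum (fun s => w z 0 s * w (z * p) (z * p * a) s * al s
       * pochinf (a * z * p ^+ s.+1) * (1 + z * p ^+ s.*2.+1 - a * z * p ^+ s)).
Proof.
move=> h; rewrite -qsumZ; last exact/summableMr/summableMr.
pose G s n := w (z * p) (z * p * a) s * al s * pochinf (a * z * p ^+ s.+1)
              * (w z 0 (s + n) * invpoch n * (1 - a * z * p ^+ (s + n))
                 * pochinf (z * p ^+ (s + n + s).+2)).
rewrite (@eq_qsum _ _ (fun N => \sum_(0 <= s < N.+1) G s (N - s)%N)); last first.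
  move=> N; rewrite mulrCA (bailey_step p_dvq _ h) mulr_sumr.
  apply: eq_big_nat => s /andP[_ sN]; rewrite /G subnKC //.
  rewrite (pochinf_split p_dvq (a * z * p ^+ s.+1) (N - s)) (pochinfSX p_dvq (a * z) N).
  have -> : a * z * p ^+ s.+1 * p ^+ (N - s) = a * z * p ^+ N.+1.
    by rewrite -mulrA -exprD addSn subnKC.
  rewrite -[z * p * p ^+ (N + s).+1]mulrA -exprS.
  rewrite (_ : z * p * a * p ^+ s = a * z * p ^+ s.+1); [ring|by rewrite exprS; ring].
rewrite qsum_exch => [|s n]; last exact/dvq_mull/dvq_mulr/dvq_mulr/dvq_mulr/w0_summable.
apply: eq_qsum => s; rewrite /G; set c := _ * al s * _.
pose y := z * p ^+ s.*2.
pose F1 n := w y 0 n * invpoch n * pochinf (y * p ^+ n.+2).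
pose F2 n := w (y * p) 0 n * invpoch n * pochinf (y * p * p ^+ n.+1).
have s1 : summable F1 by apply/summableMr/summableMr.
have s2 : summable F2 by apply/summableMr/summableMr.
rewrite (@eq_qsum _ _ (fun n => c * w z 0 s * (F1 n - a * z * p ^+ s * F2 n))); last first.
  move=> n; rewrite /F1 /F2 /y w_add mul0r w0_scale -[z * _ * p * p ^+ _]mulrA -exprS.
  rewrite -[z * _ * p ^+ n.+2]mulrA -exprD [p ^+ (s + n)]exprD.
  by rewrite (_ : (s.*2 + n.+2)%N = (s + n + s).+2); [ring|lia].
have s3 : summable (fun n => a * z * p ^+ s * F2 n) by apply: summableMl.
rewrite qsumZ; last by move=> n; apply: dvqB.
rewrite qsumB // qsumZ // cauchy // cauchy' // /y [p ^+ s.*2.+1]exprSr /c; ring.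
Qed.

(** The part of the summand of J_i that does not depend on i. *)
Definition tau m z n : R :=
  start_alpha z n * w z 0 n ^+ m * w z (z * a) n * pochinf (a * z * p ^+ n.+1).

(* The single sum J_i of the given k, up to normalisation, where m = k - 2,
   u = i - 1 and v = k - i.  The exponents u and v are exchanged by the
   q-difference equation. *)
Definition single m u v z : R := qsum (fun n => tau m z n * (p ^+ n) ^+ v *
  (1 - a * z * p ^+ n
   - (z * p * (p ^+ n) ^+ 2) ^+ u * (z * p ^+ n * (p ^+ n.+1 - a)))).

Lemma waS z n : w z (z * a) n.+1 = w z (z * a) n * (p ^+ n * z * (p ^+ n.+1 - a)).
Proof. by rewrite wSr; ring. Qed.

Lemma multisum_single k i z : (2 <= i)%N -> (i <= k)%N -> (2 < k)%N ->
  pochinf (z * p) * multisum k i z = single (k - 2) i.-1 (k - i) z.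
Proof.
move=> i2 ik k2; have [->|i_neq2] := eqVneq i 2.
  rewrite /multisum (_ : k - 2 = (k - 3).+1)%N; last by lia.
  under eq_qsum do rewrite nestS.
  rewrite (bailey_last_shift (@nest_bailey_hi 2 z 3 (k - 3) isT isT)).
  apply: eq_qsum => s; rewrite /tau w0_scale.
  rewrite (_ : z * p * a = p * (z * a)); last by ring.
  rewrite [z * p]mulrC w_scale expr1 (_ : p ^+ s.*2.+1 = p * (p ^+ s) ^+ 2); last first.
    by rewrite exprS -exprM muln2.
  rewrite !exprS exprMn; ring.
(* Here i >= 3: v = k - i plain steps come before the change of base and d = i - 3 after it. *)
have [d [v [-> -> -> ->]]] : exists d v,
    [/\ i = d.+3, k = (d.+3 + v)%N, (k - 2 = (d + v).+1)%N & (k - i = v)%N].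
  by exists (i - 3)%N, (k - i)%N; split; lia.
rewrite /multisum; under eq_qsum do rewrite nestS /=.
rewrite (bailey_last (@nest_bailey_lo d.+3 z 3 d v erefl isT)) /single.
pose f s := w z 0 s ^+ d.+1 * w z (z * a) s * pochinf (a * z * p ^+ s).
have sf : summable f.
  by apply/summableMr/summableMr => s; rewrite exprS; apply/dvq_mulr/w0_summable.
pose g s := w (z * p) 0 s ^+ v * start_alpha z s.
pose h s := if s is s'.+1 then z * p ^+ s'.*2.+1 * g s' else 0.
transitivity (qsum (fun s => f s * g s - f s * h s)).
  apply: eq_qsum => s; rewrite /f -/(g s) -/(h s) exprS; ring.
rewrite qsumB; [|exact: summableMr|exact: summableMr].
(* The subtracted part has no term at s = 0; shifting its index brings both parts to the same
   [tau]. *)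
rewrite [X in _ - X]qsum_recl; last exact: summableMr.
rewrite mulr0 add0r -qsumB; [|exact: summableMr|exact/summableMr/summableS].
apply: eq_qsum => s; rewrite /f /h /g /tau waS (pochinfSX p_dvq (a * z) s) w0_scale.
have -> : w z 0 s.+1 = z * p * (p ^+ s) ^+ 2 * w z 0 s by rewrite wSr exprS; ring.
have -> : p ^+ s.*2.+1 = p * (p ^+ s) ^+ 2 by rewrite exprS -exprM muln2.
rewrite [p ^+ s.+1]exprS -addSn exprD ![(_ * w z 0 s) ^+ _]exprMn [_ ^+ d.+2]exprS.
set e := pochinf _; ring.
Qed.

End MultiSum.

(** * q-difference equations for the single sum *)

Section SingleSum.
Variable A : idomainType.
Local Notation R := (fps A).
Variables p a b : R.
Hypothesis p_dvq : dvq 1 p.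
Local Notation poch := (poch p).
Local Notation pochinf := (pochinf p).
Local Notation w := (w p).
Local Notation unit_alpha := (unit_alpha p).
Local Notation start_alpha := (start_alpha p b).
Local Notation tau := (tau p a b).
Local Notation single := (single p a b).
Implicit Types (z : R).

(** For a = 0 the last factor of [single] becomes this one with i = u + 1. In general [single]
    combines two such sums, which will match the partitions with f_1 = 0 and f_1 = 1. *)
Definition halfsum m i v z : R :=
  qsum (fun n => tau m z n * (p ^+ n) ^+ v * (1 - (z * p * (p ^+ n) ^+ 2) ^+ i)).

Let bp_dvq : dvq 1 (b * p). Proof. exact: dvq_mull. Qed.

Lemma tau_summable m z : summable (tau m.+1 z).
Proof.
by apply/summableMr/summableMr/summableMl => n; rewrite exprS; apply/dvq_mulr/w_summable/dvq0.
Qed.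

Lemma single_halfsum m u v z :
  single m.+1 u v z = halfsum m.+1 u.+1 v z - a * z * halfsum m.+1 u v.+1 z.
Proof.
have st := @tau_summable m z.
rewrite -qsumZ; last exact/summableMr/summableMr.
rewrite -qsumB; [|exact/summableMr/summableMr|exact/summableMl/summableMr/summableMr].
apply: eq_qsum => n; rewrite [_ ^+ u.+1]exprS [p ^+ n.+1]exprS [_ ^+ v.+1]exprS; ring.
Qed.

Lemma halfsum0 m v z : halfsum m.+1 0 v z = 0.
Proof. by apply: qsum0 => n; rewrite expr0 subrr mulr0. Qed.

(** This shift of n and the shift of z in [start_alpha_shift] let [single_shift] recognise the
    regrouped terms as J at z p. *)
Lemma start_alphaS z n :
  start_alpha z n.+1 * (1 - p ^+ n.+1) * (1 - b * p ^+ n.+1)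
  = - start_alpha z n * p ^+ n * (1 - z * p ^+ n.+1) * (p ^+ n * (z * p ^+ n.+2 - b * p)).
Proof.
have u1 : poch (b * p) n \is a GRing.unit by apply: poch_unit.
have u2 : poch (b * p) n.+1 \is a GRing.unit by apply: poch_unit.
have -> : start_alpha z n.+1 * (1 - p ^+ n.+1) * (1 - b * p ^+ n.+1)
  = w (z * p) (b * p) n.+1 * ((poch (b * p) n.+1)^-1 * (1 - b * p ^+ n.+1))
     * (unit_alpha (z * p) n.+1 * (1 - p ^+ n.+1)) by rewrite /start_alpha; ring.
have -> : (poch (b * p) n.+1)^-1 * (1 - b * p ^+ n.+1) = (poch (b * p) n)^-1.
  apply: (mulrI u1); rewrite mulrCA exprS (mulrA b) -pochSr mulVr // mulrV //.
rewrite unit_alphaS // wSr /start_alpha !exprS; ring.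
Qed.

Lemma start_alpha_shift z n :
  (z * p - b) * (1 - z * p) * start_alpha (z * p) n
  = start_alpha z n * (1 - z * p ^+ n.+1) * (z * p ^+ n.+1 - b).
Proof.
rewrite /start_alpha.
have ew : (z * p - b) * w (z * p * p) (b * p) n
    = w (z * p) (b * p) n * (z * p ^+ n.+1 - b).
  elim: n => [|n IHn]; first by rewrite !w0 expr1; ring.
  rewrite wSr mulrA IHn wSr !exprS; ring.
have eg : (1 - z * p) * unit_alpha (z * p * p) n = unit_alpha (z * p) n * (1 - z * p ^+ n.+1).
  rewrite /unit_alpha mulrA [RHS]mulrAC; congr (_ * _).
  elim: n {ew} => [|n IHn]; first by rewrite !big_nil expr1; ring.
  rewrite !big_nat_recr //= mulrA IHn !exprS; ring.
transitivity (((z * p - b) * w (z * p * p) (b * p) n) * (poch (b * p) n)^-1 *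
              ((1 - z * p) * unit_alpha (z * p * p) n)); first by ring.
by rewrite ew eg; ring.
Qed.

(* Every q-difference equation below is an instance of this regrouping: the
   first half of the summand at n + 1 is paired with the second half at n. *)
Lemma single_shift m u v z : (m.+2 = u + v)%N ->
  qsum (fun n => tau m.+1 z n * (p ^+ n) ^+ v *
    (z * p * (1 - p ^+ n) * (1 - b * p ^+ n)
     + (z * p * (p ^+ n) ^+ 2) ^+ u * (1 - z * p ^+ n.+1) * (z * p ^+ n.+1 - b)))
  = (z * p) ^+ u * (z * p - b) * (1 - z * p) * single m.+1 v u (z * p).
Proof.
move=> muv; have st z' := @tau_summable m z'.
pose F n := tau m.+1 z n * (p ^+ n) ^+ v * (z * p * (1 - p ^+ n) * (1 - b * p ^+ n)).
pose G n := tau m.+1 z n * (p ^+ n) ^+ v *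
   ((z * p * (p ^+ n) ^+ 2) ^+ u * (1 - z * p ^+ n.+1) * (z * p ^+ n.+1 - b)).
have sF : summable F by apply/summableMr/summableMr.
have sG : summable G by apply/summableMr/summableMr.
transitivity (qsum (fun n => F n + G n)).
  by apply: eq_qsum => n; rewrite /F /G; ring.
(* The first half vanishes at n = 0 because of 1 - p^n, so its index can be shifted. *)
rewrite qsumD // [X in X + _]qsum_recl // {1}/F expr0 subrr mulr0 mul0r mulr0 add0r.
rewrite -qsumD //; last exact: summableS.
rewrite -qsumZ; last exact/summableMr/summableMr.
apply: eq_qsum => n.
pose y := p ^+ n.
have eF : F n.+1 = - start_alpha z n * y * (1 - z * p ^+ n.+1) * (y * (z * p ^+ n.+2 - b * p))
     * w z 0 n.+1 ^+ m.+1 * w z (z * a) n.+1 * pochinf (a * z * p ^+ n.+2) * (p ^+ n.+1) ^+ v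
     * (z * p).
  by rewrite -start_alphaS /F /tau; ring.
have -> : (z * p) ^+ u * (z * p - b) * (1 - z * p) *
  (tau m.+1 (z * p) n * (p ^+ n) ^+ u *
   (1 - a * (z * p) * p ^+ n -
    (z * p * p * (p ^+ n) ^+ 2) ^+ v * (z * p * p ^+ n * (p ^+ n.+1 - a))))
  = (z * p) ^+ u * (start_alpha z n * (1 - z * p ^+ n.+1) * (z * p ^+ n.+1 - b)) *
    w (z * p) 0 n ^+ m.+1 * w (z * p) (z * p * a) n * pochinf (a * z * p ^+ n.+2)
      * y ^+ u * (1 - a * z * p * y - (z * p * p * y ^+ 2) ^+ v * (z * p * y * (p ^+ n.+1 - a))).
  rewrite -start_alpha_shift /tau -/y.
  have -> : a * (z * p) * p ^+ n.+1 = a * z * p ^+ n.+2 by rewrite [p ^+ n.+2]exprS; ring.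
  ring.
rewrite {}eF /G /tau w0_scale // (pochinfSX p_dvq (a * z) n.+1) waS.
have -> : w (z * p) (z * p * a) n = y * w z (z * a) n.
  by rewrite (_ : z * p * a = p * (z * a)) 1?[z * p]mulrC ?w_scale //; ring.
have -> : w z 0 n.+1 = z * p * y ^+ 2 * w z 0 n by rewrite wSr exprS -/y; ring.
rewrite [p ^+ n.+2]exprS [p ^+ n.+1]exprS -/y !expr2 !exprMn ![_ ^+ m.+1]exprS.
set e := pochinf _.
have eX (c : R) : c ^+ m * (c * c) = c ^+ u * c ^+ v by rewrite -expr2 -!exprD addn2 muv.
have eX' : z ^+ m * p ^+ m * (y ^+ m * y ^+ m) * (z * z * p * p * y * y * y * y)
   = z ^+ u * z ^+ v * p ^+ u * p ^+ v * (y ^+ u * y ^+ v * y ^+ u * y ^+ v).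
  transitivity (z ^+ m * (z * z) * (p ^+ m * (p * p)) * (y ^+ m * (y * y)) * (y ^+ m * (y * y))).
    ring.
  by rewrite !eX; ring.
set K := start_alpha z n * (1 - z * (p * y)) * (z * (p * y) - b) * w z 0 n * w z 0 n ^+ m
   * w z (z * a) n * e.
(* As [ring] does not know m + 2 = u + v, the difference of the two sides is written as a
   combination of [eX'] and of [eX] at y. *)
apply/eqP; rewrite -subr_eq0; apply/eqP.
transitivity (- K * (p * y - a) * p ^+ v * y ^+ v * (z * p * y) *
    (z ^+ m * p ^+ m * (y ^+ m * y ^+ m) * (z * z * p * p * y * y * y * y)
   - z ^+ u * z ^+ v * p ^+ u * p ^+ v * (y ^+ u * y ^+ v * y ^+ u * y ^+ v))
  - K * z ^+ u * p ^+ u * y ^+ u * (1 - a * z * p * y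
       - z ^+ v * p ^+ v * p ^+ v * y ^+ v * y ^+ v * (z * p * y * (p * y - a)))
    * (y ^+ m * (y * y) - y ^+ u * y ^+ v)); last first.
  by rewrite eX' eX !subrr !mulr0 subrr.
by rewrite /K; ring.
Qed.

(** Division by (zp;p)_oo turns [single] into the multiple sum for i >= 2 and absorbs the factor 1 -
    z p of [single_shift]. *)
Definition single_norm k i z : R :=
  (pochinf (z * p))^-1 * single (k - 2) i.-1 (k - i) z.
Definition half_norm k i z : R :=
  (pochinf (z * p))^-1 * halfsum (k - 2) i (k - i) z.

Let pochinf_u z : pochinf (z * p) \is a GRing.unit.
Proof. by apply: pochinf_unit => //; apply: dvq_mull. Qed.

Lemma pochinf_inv_shift z f :
  (pochinf (z * p))^-1 * ((1 - z * p) * f) = (pochinf (z * p * p))^-1 * f.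
Proof.
apply: (mulrI (pochinf_u z)); rewrite mulVKr // [pochinf (z * p) in RHS](pochinfS p_dvq).
by rewrite -[RHS]mulrA mulVKr //; apply: pochinf_u.
Qed.

Section Norm.
Variable k : nat.
Hypothesis k3 : (2 < k)%N.
Local Notation J := (single_norm k).
Local Notation H := (half_norm k).

Let k2E : (k - 2 = (k - 3).+1)%N. Proof. lia. Qed.

Lemma single_half_norm i z : (0 < i <= k)%N -> J i z = H i z - a * z * H i.-1 z.
Proof.
case: i => [//|i] /andP[_ ik]; rewrite /single_norm /half_norm k2E single_halfsum /=.
rewrite (_ : (k - i)%N = (k - i.+1).+1); [ring|lia].
Qed.

Lemma half_norm0 z : H 0 z = 0.
Proof. by rewrite /half_norm k2E halfsum0 mulr0. Qed.

Let single_shift_norm i z : (i < k)%N ->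
  (pochinf (z * p))^-1 * qsum (fun n => tau (k - 2) z n * (p ^+ n) ^+ (k - i.+1) *
    (z * p * (1 - p ^+ n) * (1 - b * p ^+ n)
     + (z * p * (p ^+ n) ^+ 2) ^+ i * (1 - z * p ^+ n.+1) * (z * p ^+ n.+1 - b)))
  = (z * p) ^+ i * (z * p - b) * J (k - i) (z * p).
Proof.
move=> ik; rewrite k2E single_shift; last by lia.
rewrite -[_ * (1 - z * p) * _]mulrA mulrCA pochinf_inv_shift /single_norm k2E.
by rewrite (_ : (k - i).-1 = k - i.+1)%N ?subKn //; lia.
Qed.

(** At i = 0 the bracket of [single_shift_norm] factors as (z p - b) (1 - z p p^(2n)). *)
Lemma half_norm1 z : z * p != b -> H 1 z = J k (z * p).
Proof.
move=> zpb; have zpb' : z * p - b != 0 by rewrite subr_eq0.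
apply: (mulfI zpb'); have := @single_shift_norm 0 z (ltnW (ltnW k3)).
rewrite expr0 mul1r subn0 => <-; rewrite /half_norm mulrCA; congr (_ * _).
rewrite -qsumZ; last by rewrite k2E; apply/summableMr/summableMr/tau_summable.
apply: eq_qsum => n; rewrite expr1 expr0 [p ^+ n.+1]exprS; ring.
Qed.

(** Up to the factor z p, the bracket of [single_shift_norm] at i + 1 is a second-order difference
    in i of the summands of H, with characteristic roots 1 and b. *)
Lemma half_normSS i z : z * p != 0 -> (i.+1 < k)%N ->
  H i.+2 z = (1 + b) * H i.+1 z - b * H i z
             + (z * p) ^+ i * (z * p - b) * J (k - i.+1) (z * p).
Proof.
move=> zp0 ik; apply: (mulfI zp0); rewrite mulrDr.
have -> : z * p * ((z * p) ^+ i * (z * p - b) * J (k - i.+1) (z * p))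
  = (z * p) ^+ i.+1 * (z * p - b) * J (k - i.+1) (z * p) by rewrite exprS; ring.
rewrite -single_shift_norm // /half_norm.
have -> : (k - i.+1 = (k - i.+2).+1)%N by lia.
have -> : (k - i = (k - i.+2).+2)%N by lia.
set u := (k - i.+2)%N; set c := (pochinf _)^-1.
have st v n (f : R) : dvq n (tau (k - 2) z n * (p ^+ n) ^+ v * f).
  by rewrite k2E; apply/dvq_mulr/dvq_mulr/tau_summable.
transitivity (c * (z * p * halfsum (k - 2) i.+2 u z)); first by ring.
transitivity (c * (z * p * ((1 + b) * halfsum (k - 2) i.+1 u.+1 z
                  - b * halfsum (k - 2) i u.+2 z) +
   qsum (fun n : nat =>
      tau (k - 2) z n * p ^+ n ^+ u *
      (z * p * (1 - p ^+ n) * (1 - b * p ^+ n) +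
       (z * p * p ^+ n ^+ 2) ^+ i.+1 * (1 - z * p ^+ n.+1) * (z * p ^+ n.+1 - b)))));
  last by ring.
congr (_ * _).
rewrite -!qsumZ; try by move=> n; apply: st.
rewrite -qsumB; try by move=> n; apply/dvq_mull/st.
rewrite -qsumZ; last by move=> n; apply: dvqB; apply/dvq_mull/st.
rewrite -qsumD; first 1 last.
- by move=> n; apply: dvq_mull; apply: dvqB; apply/dvq_mull/st.
- by move=> n; apply: st.
apply: eq_qsum => n; rewrite !exprS; ring.
Qed.

End Norm.
End SingleSum.

(** * The recursion shared by the multiple sum and the partitions *)

Section Recursion.
Variable A : idomainType.
Local Notation R := (fps A).
Variables (p a : R) (e : bool) (k : nat).
Implicit Types (z : R) (J : nat -> R -> R).

(* For partitions, the summand c counts those with f_1 = 0 and f_2 = c, and e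
   is true for j = 0.  The term - a z ladder J i.-1 z counts those with f_1 = 1. *)
Definition ladder J i z : R :=
  \sum_(0 <= c < i) (z * p) ^+ c * J (k - c - (e && odd (c + i.-1)))%N (z * p).

Definition ladder_rec J := forall i z, (0 < i <= k)%N -> z != 0 ->
  J i z = ladder J i z - a * z * ladder J i.-1 z.

End Recursion.

Section SingleRecursion.
Variable A : idomainType.
Local Notation R := (fps A).
Variables (p a : R) (k : nat).
Hypotheses (p_dvq : dvq 1 p) (p_neq0 : p != 0) (k3 : (2 < k)%N).

Lemma ladder_rec_half e b :
  (forall j z, (j <= k)%N -> z != 0 ->
     half_norm p a b k j z = ladder p e k (single_norm p a b k) j z) ->
  ladder_rec p a e k (single_norm p a b k).
Proof. by move=> HE i z ik z0; rewrite single_half_norm // !HE //; lia. Qed.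

(** For b = 0, [half_normSS] adds one term of the ladder at a time. *)
Lemma single_norm_rec0 : ladder_rec p a false k (single_norm p a 0 k).
Proof.
apply: ladder_rec_half => j z jk z0; have zp0 : z * p != 0 by rewrite mulf_neq0.
have [n jn] := ubnP j; elim: n j jn jk => // n IHn [|[|j]] jn jk.
- by rewrite half_norm0 // /ladder big_nil.
- by rewrite half_norm1 // /ladder big_nat1 mul1r !subn0.
rewrite half_normSS // IHn; try lia.
rewrite /ladder [RHS]big_nat_recr //= !subn0 [_ ^+ j.+1]exprS; ring.
Qed.

(** For b = -1, [half_normSS] goes from H_j to H_(j+2) and adds the terms c = j and c = j + 1
    together; both have index k - j - 1, whence the parity in [ladder]. *)
Lemma single_norm_rec1 : ladder_rec p a true k (single_norm p a (-1) k).
Proof.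
apply: ladder_rec_half => j z jk z0; have zp0 : z * p != 0 by rewrite mulf_neq0.
have [n jn] := ubnP j; elim: n j jn jk => // n IHn [|[|j]] jn jk.
- by rewrite half_norm0 // /ladder big_nil.
- rewrite half_norm1 //; first by rewrite /ladder big_nat1 mul1r !subn0.
  (* z p = -1 is impossible because q divides z p. *)
  apply/eqP => zp1; apply: (@dvqn1_neq0 _ (- (z * p))); last by rewrite zp1 opprK.
  exact/dvqN/dvq_mull.
rewrite half_normSS // [half_norm _ _ _ _ j _]IHn; try lia.
rewrite /ladder !big_nat_recr //=.
have -> : odd (j + j.+1) = true by rewrite addnS addnn /= odd_double.
rewrite /= subn0.
have -> : (k - j - 1 = k - j.+1)%N by lia.
have -> : \sum_(0 <= c < j) (z * p) ^+ c
     * single_norm p a (-1) k (k - c - odd (c + j.+1)) (z * p)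
  = \sum_(0 <= c < j) (z * p) ^+ c
     * single_norm p a (-1) k (k - c - odd (c + j.-1)) (z * p).
  by apply: eq_big_nat => c /andP[_ cj]; case: (j) cj => // j' _; rewrite !addnS /= negbK.
by rewrite [_ ^+ j.+1]exprS; ring.
Qed.

End SingleRecursion.

(** * Uniqueness of the solution *)

Section Uniqueness.
Variable A : idomainType.
Local Notation R := (fps A).
Variables (p a : R) (k : nat).
Hypotheses (p_dvq : dvq 1 p) (p_neq0 : p != 0).
Implicit Types (z : R) (J : nat -> R -> R).

(** A q-adic form of the condition that J i z tends to 1 when z tends to 0. *)
Definition tends_to_1 J := forall m i z, (0 < i <= k)%N ->
  dvq m z -> dvq m (J i z - 1).

Lemma ladder_dvq e J J' m i z : (i <= k)%N ->
  (forall i', (0 < i' <= k)%N -> dvq m (J i' (z * p) - J' i' (z * p))) ->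
  dvq m (ladder p e k J i z - ladder p e k J' i z).
Proof.
move=> ik h; rewrite /ladder -sumrB; apply: dvq_sum_nat => c /andP[_ ci].
rewrite -mulrBr; apply/dvq_mull/h.
case: (e) => /=; last by lia.
have [ck|ck] := leqP c.+2 k; first by case: odd => /=; lia.
(* Here c = k - 1 and i = k, so the parity is even and the index k - c = 1 is not lowered to 0. *)
have -> : odd (c + i.-1) = false.
  by rewrite (_ : (c + i.-1 = c.*2)%N) ?odd_double //; lia.
rewrite /=; lia.
Qed.

Lemma ladder_rec_unique e J J' :
  ladder_rec p a e k J -> ladder_rec p a e k J' -> tends_to_1 J -> tends_to_1 J' ->
  forall i z, (0 < i <= k)%N -> z != 0 -> J i z = J' i z.
Proof.
move=> hJ hJ' lJ lJ' i z ik z0; apply: dvq_eq => m.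
(* s bounds the number of substitutions z -> z p after which q^m divides z and both solutions are 1
   modulo q^m. *)
have := dvq_zpX p_dvq z m; move: {2}m => s.
elim: s i z ik z0 => [|s IHs] i z ik z0.
  rewrite expr0 mulr1 => hz; apply: dvq_trans (lJ _ _ _ ik hz) _.
  exact/dvq_sym/lJ'.
rewrite exprS mulrA => hz.
have h i' : (0 < i' <= k)%N -> dvq m (J i' (z * p) - J' i' (z * p)).
  by move=> i'k; apply: IHs => //; rewrite mulf_neq0.
rewrite hJ // hJ' // opprD opprK addrACA; apply: dvqD.
  by apply: ladder_dvq => //; lia.
rewrite addrC -mulrBr; apply: dvq_mull; apply: ladder_dvq => [|i' i'k]; first by lia.
exact/dvq_sym/h.
Qed.

Lemma nest_0 b i z r l : nest p a b i z r l 0 = 1.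
Proof.
elim: l r => [|l IHl] r; first by rewrite /= invpoch0 poch0 invr1 mulr1.
by rewrite nestS big_nat1 w0 subn0 invpoch0 IHl !mulr1.
Qed.

(** All terms but that of N_1 = 0 are divisible by z. *)
Lemma multisum_dvq b i z m : dvq m z -> dvq m (multisum p a b k i z - 1).
Proof.
move=> hz.
have sm : summable (fun N => w p z 0 N * pochinf p (a * z * p ^+ N) * nest p a b i z 2 (k - 2) N).
  exact/summableMr/summableMr/w_summable/dvq0.
rewrite /multisum qsum_recl // w0 nest_0 mul1r mulr1 addrAC; apply: dvqD.
  exact/dvq_pochinf/dvq_mulr/dvq_mull.
apply: dvq_qsum => [|n]; first exact: summableS sm.
by rewrite w0S -!mulrA; apply/dvq_mulr.
Qed.

(* For i = 1 the multiple sum does not have the right form, but the recursion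
   forces J 1 z = J k (z p). *)
Definition multisum_ext b i z : R :=
  if i == 1%N then multisum p a b k k (z * p) else multisum p a b k i z.

Lemma multisum_tends_to_1 b : tends_to_1 (multisum_ext b).
Proof.
move=> m i z _ hz; rewrite /multisum_ext; case: eqP => _; apply: multisum_dvq => //.
exact: dvq_mulr.
Qed.

Lemma eq_ladder_rec e J J' :
  (forall i z, (0 < i <= k)%N -> z != 0 -> J i z = J' i z) ->
  ladder_rec p a e k J -> ladder_rec p a e k J'.
Proof.
move=> hJ h i z ik z0; rewrite -hJ // h //.
have E j : (j <= k)%N -> ladder p e k J j z = ladder p e k J' j z.
  move=> jk; apply: dvq_eq => m; apply: ladder_dvq => // i' i'k.
  by rewrite hJ ?subrr ?mulf_neq0 //; apply: dvq0.
by rewrite !E //; lia.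
Qed.

Lemma single_norm_multisum e b i z : (2 < k)%N -> (0 < i <= k)%N -> z != 0 ->
  ladder_rec p a e k (single_norm p a b k) -> single_norm p a b k i z = multisum_ext b i z.
Proof.
move=> k3 ik z0 h; rewrite /multisum_ext.
have ge2 j y : (1 < j <= k)%N -> single_norm p a b k j y = multisum p a b k j y.
  move=> /andP[j1 jk]; rewrite /single_norm -multisum_single // mulKr //.
  by apply: pochinf_unit => //; apply: dvq_mull.
case: eqP => [->|i1]; last by apply: ge2; lia.
rewrite h ?(ltnW (ltnW k3)) // /ladder big_nat1 big_nil mulr0 subr0 mul1r andbF !subn0.
by apply: ge2; lia.
Qed.

(** A direct check: 1 - a z p^N = (1 - p^N) + (1 - a z) p^N splits the sum, and shifting the index
    in the first part gives z p times the sum at z p^2. *)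
Lemma multisum_rec2 : k = 2 -> ladder_rec p a false k (multisum_ext 0).
Proof.
rewrite /multisum_ext => k2 [|[|[|i]]] z; rewrite k2 //= => _ z0.
  by rewrite /ladder big_nat1 big_nil mul1r mulr0 subr0.
pose t z N := w p z 0 N * pochinf p (a * z * p ^+ N) * invpoch p N.
have st y : summable (t y) by apply/summableMr/summableMr/w_summable/dvq0.
have mE y : multisum p a 0 2 2 y = qsum (t y).
  by apply: eq_qsum => N; rewrite /= mul0r poch_zero invr1 mulr1.
rewrite /ladder big_nat1 big_nat_recl // big_nat1 /= !mE !mul1r expr1.
pose u N := w p z 0 N * pochinf p (a * z * p ^+ N.+1) * invpoch p N * (1 - p ^+ N).
have su : summable u by apply/summableMr/summableMr/summableMr/w_summable/dvq0.
have st' c y : summable (fun N => c * t y N) by apply: summableMl.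
transitivity (qsum u + (1 - a * z) * qsum (t (z * p))).
  rewrite -qsumZ // -qsumD //; apply: eq_qsum => N; rewrite /t /u w0_scale.
  rewrite (pochinfSX p_dvq (a * z) N) (_ : a * (z * p) * p ^+ N = a * z * p ^+ N.+1).
    by ring.
  by rewrite exprS; ring.
rewrite [qsum u]qsum_recl // {1}/u expr0 subrr mulr0 add0r.
rewrite (@eq_qsum _ _ (fun N => z * p * t (z * p * p) N)) ?qsumZ //; first by ring.
move=> N; rewrite /t /u w0S (invpochS p_dvq N).
rewrite (_ : a * (z * p * p) * p ^+ N = a * z * p ^+ N.+2); last by rewrite !exprS; ring.
by rewrite (_ : z * p ^+ 2 = z * p * p); ring.
Qed.

Theorem ladder_rec_multisum (e : bool) J i z :
  (if e then 2 < k else 1 < k)%N ->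
  ladder_rec p a e k J -> tends_to_1 J -> (1 < i <= k)%N -> z != 0 ->
  J i z = multisum p a (- e%:R) k i z.
Proof.
move=> ke hJ lJ ik z0; have i1 : i != 1%N by lia.
transitivity (multisum_ext (- e%:R) i z); last by rewrite /multisum_ext (negPf i1).
apply: (ladder_rec_unique hJ _ lJ (@multisum_tends_to_1 _)) => //; last by lia.
case: e ke {hJ} => [k3|k2].
  rewrite mulr1n.
  apply: eq_ladder_rec (single_norm_rec1 _ p_dvq p_neq0 k3) => j y jk y0.
  apply: single_norm_multisum => //; exact: single_norm_rec1.
rewrite oppr0; have [k3|] := ltnP 2 k; last by move=> ?; apply: multisum_rec2; lia.
apply: eq_ladder_rec (single_norm_rec0 _ p_dvq p_neq0 k3) => j y jk y0.
apply: single_norm_multisum => //; exact: single_norm_rec0.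
Qed.

End Uniqueness.

(** * Partitions *)

Section Partitions.
Local Open Scope nat_scope.
Implicit Types (l mu : seq nat).

(** Raising all parts by 2 corresponds to z -> z q^2 in the generating function. *)
Definition extend e c mu := map (addn 2) mu ++ nseq c 2 ++ nseq e 1.
Definition strip l := [seq x - 2 | x <- l & 2 < x].

Lemma size_extend e c mu : size (extend e c mu) = size mu + c + e.
Proof. by rewrite !size_cat size_map !size_nseq addnA. Qed.

Lemma sumn_extend e c mu :
  sumn (extend e c mu) = sumn mu + (size mu).*2 + c.*2 + e.
Proof.
rewrite !sumn_cat !sumn_nseq mul1n mul2n.
suff -> : sumn (map (addn 2) mu) = sumn mu + (size mu).*2 by lia.
by elim: mu => //= x mu ->; lia.
Qed.

Lemma mult_extend t e c mu :
  mult t (extend e c mu) = (if 1 < t then mult (t - 2) mu else 0) + c * (t == 2) + e * (t == 1).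
Proof.
rewrite /mult !count_cat !count_nseq /= ![_ == t]eq_sym ![_ * c]mulnC ![_ * e]mulnC addnA.
congr (_ + _ + _); rewrite count_map; case: ltnP => t2.
  by apply: eq_count => x /=; apply/eqP/eqP; lia.
by rewrite -(count_pred0 mu); apply: eq_count => x /=; apply/eqP; lia.
Qed.

Lemma odd_upto_extend e c mu N : 0 \notin mu ->
  odd_upto (extend e c mu) N.+1 = e + (if 1 < N then odd_upto mu (N - 1) else 0).
Proof.
move=> mu0; rewrite /odd_upto !count_cat !count_nseq /= mul0n mul1n add0n addnC count_map.
congr (_ + _); case: ltnP => N1.
  by apply: eq_count => x /=; rewrite negbK; congr (_ && _); lia.
rewrite -(count_pred0 mu); apply: eq_in_count => x xmu /=.
have : x != 0 by apply: contraNneq mu0 => <-.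
by move=> x0; apply/negbTE/negP => /andP[_]; lia.
Qed.

Let geq_trans : transitive geq.
Proof. by move=> b a c ba cb; apply: leq_trans cb ba. Qed.

Lemma stripK l : is_partition l -> extend (mult 1 l) (mult 2 l) (strip l) = l.
Proof.
move=> /andP[sl l0]; rewrite /extend /strip -map_comp.
have -> : [seq (addn 2 \o subn^~ 2) x | x <- l & 2 < x] = [seq x <- l | 2 < x].
  rewrite -[RHS]map_id; apply/eq_in_map => x.
  by rewrite mem_filter => /andP[x2 _] /=; lia.
rewrite /mult; elim: l sl l0 => //= x l IHl xl.
rewrite inE negb_or => /andP[x0 l0]; have sl := path_sorted xl.
have /allP lx := order_path_min geq_trans xl.
have {}IHl := IHl sl l0; have [x2|x2] := ltnP 2 x.
  by rewrite (gtn_eqF x2) (gtn_eqF (ltnW x2)) /= !add0n IHl.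
have f0 : [seq y <- l | 2 < y] = [::].
  rewrite -(filter_pred0 l); apply: eq_in_filter => y /lx /=; lia.
rewrite f0 /= in IHl *; move: x0 x2 lx; case: x {xl} => [|[|[|x]]] //= _ _ lx.
  have c0 : count_mem 2 l = 0.
    by rewrite -(count_pred0 l); apply: eq_in_count => y /lx /=; lia.
  by rewrite c0 /= in IHl *; rewrite add0n IHl.
by rewrite !add0n IHl.
Qed.

Lemma extend_partition e c mu : is_partition mu -> is_partition (extend e c mu).
Proof.
rewrite /is_partition !sorted_pairwise // => /andP[sm m0]; apply/andP; split.
  rewrite !pairwise_cat pairwise_map; apply/and3P; split.
  - apply/allrelP => x y /mapP[z zmu ->].
    by rewrite mem_cat !mem_nseq /= => /orP[] /andP[_ /eqP->]; lia.
  - by apply: sub_pairwise sm => x y /=; lia.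
  apply/and3P; split.
  - by apply/allrelP => x y; rewrite !mem_nseq => /andP[_ /eqP->] /andP[_ /eqP->].
  - by elim: c => //= c ->; rewrite andbT; apply/allP => x; rewrite mem_nseq => /andP[_ /eqP->].
  - by elim: e => //= e ->; rewrite andbT; apply/allP => x; rewrite mem_nseq => /andP[_ /eqP->].
rewrite !mem_cat !mem_nseq !negb_or !andbF !andbT; apply/mapP => -[x _]; lia.
Qed.

Lemma strip_partition l : is_partition l -> is_partition (strip l).
Proof.
rewrite /is_partition !sorted_pairwise // => /andP[sl _]; apply/andP; split.
  rewrite pairwise_map; apply: sub_pairwise (pairwise_filter _ sl) => x y /=; lia.
by apply/mapP => -[x]; rewrite mem_filter => /andP[x2 _]; lia.
Qed.

Lemma CC_partition j k i l : CC j k i l -> is_partition l.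
Proof. by rewrite /CC; case: (j == 0); [case; case|case]. Qed.

(* If j = 0, the bound f_3 + f_4 <= k - 1 - c can be attained only if c and
   e + i - 1 have the same parity. *)
Lemma CC_extend j k i e c mu : 0 < i <= k -> e <= 1 -> is_partition mu ->
  CC j k i (extend e c mu) <->
  e + c <= i - 1 /\ CC j k (k - c - ((j == 0) && odd (c + (i - e).-1))) mu.
Proof.
move=> /andP[i0 ik] e1 pm; have m0 : 0 \notin mu by case/andP: pm.
have mu0 : mult 0 mu = 0 by apply/count_memPn.
have pe := extend_partition e c pm.
have E1 : mult 1 (extend e c mu) = e by rewrite mult_extend /=; lia.
have E2 : mult 2 (extend e c mu) = c by rewrite mult_extend /= mu0; lia.
have E0 : mult 0 (extend e c mu) = 0 by rewrite mult_extend /=; lia.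
have E3 t : mult t.+3 (extend e c mu) = mult t.+1 mu by rewrite mult_extend /= !subSS subn0; lia.
have dS t : 2 * t.+1 = (2 * t).+2 by rewrite mulnS.
have C1E : C1 k i (extend e c mu) <->
  [/\ e + c <= i - 1, forall t, mult (2 * t + 1) mu <= 1,
   forall t, mult (2 * t) mu + mult (2 * t + 1) mu + mult (2 * t + 2) mu <= k - 1
   & c + mult 1 mu + mult 2 mu <= k - 1].
  split=> [[_ h1 h2 h3]|[h1 h2 h3 h4]].
    rewrite E1 E2 in h1; split=> // [t|t|].
    - by have := h2 t.+1; rewrite dS !addn1 E3.
    - case: t => [|t]; first by have := h3 1; rewrite E2 !E3 muln0 mu0 !add0n; lia.
      by have := h3 t.+2; rewrite !dS !addn1 !addn2 !E3.
    - by have := h3 1; rewrite E2 !E3.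
  split=> // [|[|t]|[|[|t]]]; rewrite ?E1 ?E2 ?E0 ?E3 //.
  - by have := h2 t; rewrite dS !addn1 E3.
  - by rewrite add0n; lia.
  - by have := h3 t.+1; rewrite !dS !addn1 !addn2 !E3.
rewrite /CC; case: (j == 0) => /=; last first.
  rewrite subn0 C1E; split.
    move=> [h1 h2 h3 h4]; split=> //; split=> //; lia.
  by move=> [h1 [_ h2 h3 h4]]; split=> //; lia.
have O1 : odd_upto (extend e c mu) 1 = e by rewrite odd_upto_extend //= addn0.
have O3 t : odd_upto (extend e c mu) t.+3 = e + odd_upto mu t.+1.
  by rewrite odd_upto_extend //= subSS subn0.
have Om : odd_upto mu 1 = mult 1 mu.
  by apply: eq_in_count => x /(memPn m0) /= x0; case: x x0 => [|[|x]] //=; rewrite andbF.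
have O3' : odd_upto (extend e c mu) 3 = e + mult 1 mu by rewrite -Om (O3 0).
(* From here on only d <= 1 and the parity of d + c + e + i matter. *)
have parE : exists d : nat, d = odd (c + (i - e).-1) /\ d <= 1 /\ (e + c <= i - 1 ->
     d + c + e + i = 1 %[mod 2]).
  exists (odd (c + (i - e).-1) : nat); split=> //; split; first by case: odd.
  by move=> h; rewrite -modn2; lia.
case: parE => d [<- [d1 dE]].
split.
  case=> /C1E[h1 h2 h3 h4] h5; have {}dE := dE h1; split=> //.
  (* If f_2 + f_3 + f_4 = k - 1, condition (4) at t = 1 says that c and e + i - 1 have the same
     parity, that is d = 0; so d = 1 makes the bound strict. *)
  have h51 := h5 1; rewrite E2 !E3 !mul1n O3' in h51.
  split; first split=> //.
    have [] := eqVneq (c + mult 1 mu + mult 2 mu) (k - 1); last by lia.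
    by move=> /h51; lia.
  case=> [|t]; first by rewrite muln0 mu0 !mul0n !add0n mul1n Om => ?; lia.
  (* From mu to its extension the left side of (4) grows by k - 1 and the right side by e + i - (k -
     c - d); these agree modulo 2 by [dE]. *)
  have := h5 t.+2; rewrite !dS !addn1 !addn2 !E3 O3 => h /[dup] /h {}h h'.
  rewrite (mulSn t.+1) (mulSn t.+1 (mult (2 * t).+3 mu)) (mulSn t.+2) in h.
  move: h h'; move: (t.+1 * _) (t.+1 * _) (t.+2 * _) (odd_upto _ _) => x1 x2 x3 x4.
  by clear h5 h51 h2 h3 E3 dS C1E O3; lia.
move=> [h1 [[_ h2 h3 h4] h5]]; have {}dE := dE h1; split.
  by apply/C1E; split=> //; lia.
case=> [|[|t]].
(* For t = 0 the equality forces e + c = k - 1 = i - 1, and the congruence is automatic. *)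
- rewrite muln0 E0 E1 E2 O1 => ?; lia.
- rewrite E2 !E3 O3' !mul1n => ?; lia.
have := h5 t.+1; rewrite !dS !addn1 !addn2 !E3 O3 => h /[dup] /h {}h h'.
rewrite (mulSn t.+1) (mulSn t.+1 (mult (2 * t).+3 mu)) (mulSn t.+2).
move: h h'; move: (t.+1 * _) (t.+1 * _) (t.+2 * _) (odd_upto _ _) => x1 x2 x3 x4.
by clear h5 h2 h3 E3 dS C1E O3; lia.
Qed.

End Partitions.

(** * Finite truncations of the set of partitions *)

Definition bounded_seqs (N : nat) : seq (seq nat) :=
  undup (flatten [seq [seq map val (tval t) | t <- enum {: m.-tuple 'I_N}] | m <- iota 0 N]).

(** A partition of sum less than N has fewer than N parts, all less than N, so [bounded_seqs] loses
    none. *)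
Definition CC_below (j k i N : nat) : seq (seq nat) :=
  [seq l <- bounded_seqs N | `[< CC j k i l >] && (sumn l < N)%N].

Lemma mem_bounded_seqs N l :
  (l \in bounded_seqs N) = (size l < N)%N && all (fun x => x < N)%N l.
Proof.
rewrite mem_undup; apply/flatten_mapP/andP => [[m]|[sl /allP lN]].
  rewrite mem_iota add0n => mN /mapP[t _ ->]; rewrite size_map size_tuple; split=> //.
  by apply/allP => x /mapP[y _ ->]; apply: ltn_ord.
exists (size l); first by rewrite mem_iota.
have lE : map val (pmap (insub : nat -> option 'I_N) l) = l.
  by rewrite (pmap_filter (insubK _)); apply/all_filterP/allP => x /lN xN; rewrite insubT.
have sE : size (pmap (insub : nat -> option 'I_N) l) == size l by rewrite -{2}lE size_map.
by apply/mapP; exists (Tuple sE); rewrite ?mem_enum.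
Qed.

Lemma leq_sumn l x : x \in l -> (x <= sumn l)%N.
Proof. by elim: l => //= y l IHl; rewrite inE => /orP[/eqP->|/IHl]; lia. Qed.

Lemma partition_size_sumn l : is_partition l -> (size l <= sumn l)%N.
Proof.
case/andP=> _; elim: l => //= x l IHl; rewrite inE negb_or => /andP[x0 /IHl]; lia.
Qed.

Lemma mem_CC_below j k i N l :
  (l \in CC_below j k i N) = `[< CC j k i l >] && (sumn l < N)%N.
Proof.
rewrite mem_filter; case: asboolP => //= hl; case: ltnP => //= lN.
have pl := CC_partition hl; rewrite mem_bounded_seqs.
rewrite (leq_ltn_trans (partition_size_sumn pl) lN) /=.
by apply/allP => x /leq_sumn xl; apply: leq_ltn_trans xl lN.
Qed.

Lemma CC_below_uniq j k i N : uniq (CC_below j k i N).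
Proof. exact/filter_uniq/undup_uniq. Qed.

Lemma extend_inj e c mu e' c' mu' : is_partition mu -> is_partition mu' ->
  extend e c mu = extend e' c' mu' -> [/\ e = e', c = c' & mu = mu'].
Proof.
move=> /andP[_ m0] /andP[_ m0'] E.
have := congr1 (mult 1) E; rewrite !mult_extend /= !muln0 !muln1 !add0n => ee.
have mz l : 0%N \notin l -> mult 0 l = 0%N by move=> h; apply/count_memPn.
have := congr1 (mult 2) E; rewrite !mult_extend /= !mz // !muln1 !muln0 !addn0 !add0n => ec.
split=> //; have := congr1 (take (size mu)) E.
have sE : size mu = size mu' by have := congr1 size E; rewrite !size_extend ee ec; lia.
rewrite {2}sE /extend !take_size_cat ?size_map //; apply: inj_map => x y; lia.
Qed.

(** * The generating function of the partitions *)

Section GeneratingFunction.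
Variables (A : idomainType) (j k : nat).
Local Notation R := (fps A).
Local Notation q := (fpsX A).
Implicit Types (z : R) (l mu : seq nat).

Definition weight z l : R := z ^+ size l * q ^+ sumn l.

Definition CC_gf i z : R := adlim (fun N => \sum_(l <- CC_below j k i N) weight z l).

Lemma weight_dvq n z l : (n <= sumn l)%N -> dvq n (weight z l).
Proof. by move=> nl; apply: dvq_le nl _; apply: dvq_mull; exists 1; rewrite mulr1. Qed.

Lemma CC_gfP i z N : dvq N (CC_gf i z - \sum_(l <- CC_below j k i N) weight z l).
Proof.
move: N; apply: adlimP => N; rewrite (bigID (fun l => sumn l < N)%N) /=.
rewrite -[X in X + _ - _]big_filter.
rewrite (perm_big (CC_below j k i N)) /=.
  rewrite addrAC subrr add0r; apply: dvq_sum => l _; rewrite -leqNgt; apply: weight_dvq.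
apply: uniq_perm => [||l]; [exact/filter_uniq/CC_below_uniq|exact: CC_below_uniq|].
by rewrite mem_filter !mem_CC_below andbCA; congr (_ && _); lia.
Qed.

Lemma weight_extend z e c mu :
  weight z (extend e c mu) = (z * q) ^+ e * (z * q ^+ 2) ^+ c * weight (z * q ^+ 2) mu.
Proof.
rewrite /weight size_extend sumn_extend -!addnn !expr2 !exprMn !exprD; ring.
Qed.

Let idx e i c : nat := (k - c - ((j == 0) && odd (c + (i - e).-1)))%N.

(** The blocks f_1 = 0 and f_1 = 1 match the two ladders. Extension increases the sum, so entries of
    sum at least N have to be filtered out later. *)
Let CC_list i N : seq (seq nat) :=
  [seq extend 0 c mu | c <- iota 0 i, mu <- CC_below j k (idx 0 i c) N]
  ++ [seq extend 1 c mu | c <- iota 0 i.-1, mu <- CC_below j k (idx 1 i c) N].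

Lemma CC_list_perm i N : (0 < i <= k)%N ->
  perm_eq (CC_below j k i N) [seq l <- CC_list i N | (sumn l < N)%N].
Proof.
move=> ik; apply: uniq_perm; rewrite ?CC_below_uniq //.
  have pt i' l : l \in CC_below j k i' N -> is_partition l.
    by rewrite mem_CC_below => /andP[/asboolP/CC_partition].
  apply: filter_uniq; rewrite cat_uniq; apply/and3P; split.
  - apply: allpairs_uniq_dep; [exact: iota_uniq|by move=> c _; apply: CC_below_uniq|].
    move=> _ _ /allpairsPdep[c [mu [_ hmu ->]]] /allpairsPdep[c' [mu' [_ hmu' ->]]] /=.
    by case/(extend_inj (pt _ _ hmu) (pt _ _ hmu')) => _ -> ->.
  - apply/hasPn => _ /allpairsPdep[c [mu [_ hmu ->]]].
    apply/allpairsPdep => -[c' [mu' [_ hmu' E]]].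
    by case: (extend_inj (pt _ _ hmu) (pt _ _ hmu') E).
  - apply: allpairs_uniq_dep; [exact: iota_uniq|by move=> c _; apply: CC_below_uniq|].
    move=> _ _ /allpairsPdep[c [mu [_ hmu ->]]] /allpairsPdep[c' [mu' [_ hmu' ->]]] /=.
    by case/(extend_inj (pt _ _ hmu) (pt _ _ hmu')) => _ -> ->.
move=> l; rewrite mem_CC_below mem_filter andbC; apply: andb_id2l => lN.
apply/asboolP/idP => [hl|].
  have pl := CC_partition hl; have pm := strip_partition pl.
  have e1 : (mult 1 l <= 1)%N.
    by move: hl; rewrite /CC; case: (j == 0%N) => [[[_ _ h _] _]|[_ _ h _]]; apply: (h 0%N).
  move: hl; rewrite -{1}(stripK pl) => /(CC_extend _ _ ik e1 pm) [ec hm].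
  have mN c' : (idx (mult 1 l) i (mult 2 l) = c') -> strip l \in CC_below j k c' N.
    move=> <-; rewrite mem_CC_below; apply/andP; split; first exact/asboolP.
    by apply: leq_ltn_trans lN; rewrite -{2}(stripK pl) sumn_extend; lia.
  rewrite mem_cat; apply/orP; case E: (mult 1 l) e1 ec mN => [|[|//]] _ ec mN; [left|right];
    apply/allpairsPdep; exists (mult 2 l), (strip l);
    rewrite mem_iota mN // -{3}(stripK pl) E; split=> //; lia.
rewrite mem_cat => /orP[] /allpairsPdep[c [mu [ci hmu ->]]]; move: ci hmu;
  rewrite mem_iota mem_CC_below => /andP[_ ci] /andP[/asboolP hmu _];
  by apply/(CC_extend _ _ ik _ (CC_partition hmu)) => //; split=> //; lia.
Qed.

Lemma CC_gf_rec : ladder_rec (q ^+ 2) (- q) (j == 0)%N k CC_gf.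
Proof.
move=> i z ik _; rewrite mulNr mulNr opprK; apply: dvq_eq => N.
apply: dvq_trans (CC_gfP i z N) _; rewrite (perm_big _ (CC_list_perm N ik)) big_filter.
(* Dropping the filter only adds entries of sum at least N, which are 0 modulo q^N. *)
apply: (@dvq_trans _ _ _ (\sum_(l <- CC_list i N) weight z l)).
  apply: dvq_sym; rewrite [X in X - _](bigID (fun l => sumn l < N)%N) /=.
  rewrite addrAC subrr add0r; apply: dvq_sum => l _; rewrite -leqNgt; exact: weight_dvq.
rewrite big_cat /= !big_allpairs_dep opprD addrACA; apply: dvqD.
  rewrite /ladder /index_iota subn0 -sumrB; apply: dvq_sum => c _ _.
  under eq_bigr do rewrite weight_extend expr0 mul1r.
  rewrite -mulr_sumr -mulrBr; apply/dvq_mull/dvq_sym.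
  by rewrite /idx subn0; apply: CC_gfP.
rewrite /ladder /index_iota subn0 mulr_sumr -sumrB; apply: dvq_sum => c _ _.
under eq_bigr do rewrite weight_extend expr1.
rewrite -mulr_sumr; set s := \sum_(i <- _) _; set g := CC_gf _ _.
rewrite (_ : _ - _ = z * q * (z * q ^+ 2) ^+ c * (s - g)); last by ring.
by apply/dvq_mull/dvq_sym; rewrite /g /s /idx subn1; apply: CC_gfP.
Qed.

Lemma CC_nil i : (1 < k)%N -> CC j k i [::].
Proof. by move=> k1; rewrite /CC; case: (j == 0%N); split=> // t /=; lia. Qed.

Lemma CC_gf_tends_to_1 : (1 < k)%N -> tends_to_1 k CC_gf.
Proof.
move=> k1 [|m] i z _ hz; first exact: dvq_0.
apply: dvq_trans (CC_gfP i z m.+1) _; rewrite (bigD1_seq [::]) ?CC_below_uniq //=; last first.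
  by rewrite mem_CC_below andbT; apply/asboolP/CC_nil.
rewrite {1}/weight mul1r expr0 addrAC subrr add0r; apply: dvq_sum => -[|x l] // _ _.
by rewrite /weight exprS -mulrA; apply: dvq_mulr.
Qed.

End GeneratingFunction.

(** * Transfer to the fraction field *)

Section FractionField.
Local Notation qR := (fpsX {poly int}).
Definition xR : ZXq := Fps (fun n => if n == 0%N then 'X else 0).
Local Notation tf := (@tofrac ZXq).

Lemma tfM f g : tf (f * g) = tf f * tf g. Proof. exact: rmorphM. Qed.
Lemma tfB f g : tf (f - g) = tf f - tf g. Proof. exact: rmorphB. Qed.
Lemma tfN f : tf (- f) = - tf f. Proof. exact: rmorphN. Qed.
Lemma tfX f n : tf (f ^+ n) = tf f ^+ n. Proof. exact: rmorphXn. Qed.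
Lemma tf1 : tf 1 = 1. Proof. exact: rmorph1. Qed.
Lemma tfq : tf qR = q. Proof. by []. Qed.
Lemma tfx : tf xR = x. Proof. by []. Qed.

Lemma qR_dvq : dvq 1 qR.
Proof. by exists 1; rewrite mulr1. Qed.

Lemma qR_neq0 : qR != 0.
Proof. by apply/eqP => /(congr1 (fun f => fcoef f 1)) /eqP; rewrite /= oner_eq0. Qed.

Lemma xR_neq0 : xR != 0.
Proof. by apply/eqP => /(congr1 (fun f => fcoef f 0)) /eqP; rewrite /= polyX_eq0. Qed.

Lemma q_neq0 : q != 0.
Proof. by rewrite -tfq tofrac_eq0 qR_neq0. Qed.

Lemma qsmall_tofrac M f : dvq M f -> qsmall M (tf f).
Proof. by move=> [h ->]; exists h; rewrite rmorphM rmorphXn. Qed.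

Lemma qsmall_eq0 z : (forall M, qsmall M z) -> z = 0.
Proof.
move=> h; have [f zf] := h 0%N; rewrite zf expr0 mul1r.
suff -> : f = 0 by rewrite rmorph0.
apply: dvq_eq0 => M; have [g zg] := h M; exists g; apply/eqP.
by rewrite -tofrac_eq tfM tfX -zg zf expr0 mul1r.
Qed.

Lemma qcvg_unique u l l' : qcvg u l -> qcvg u l' -> l = l'.
Proof.
move=> h h'; apply/eqP; rewrite -subr_eq0; apply/eqP/qsmall_eq0 => M.
have [n0 hn] := h M; have [n1 hn'] := h' M.
have [f ef] := hn _ (leq_maxl n0 n1); have [g eg] := hn' _ (leq_maxr n0 n1).
exists (g - f); rewrite tfB mulrBr -ef -eg; ring.
Qed.

Lemma tf_poch c p n : tf (poch p c n) = qpoch (tf c) (tf p) n.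
Proof.
rewrite rmorph_prod; apply: eq_bigr => m _.
by rewrite [LHS]tfB tf1 tfM tfX.
Qed.

(** [qlim] chooses some limit; uniqueness identifies it with the image of [pochinf]. *)
Lemma qpoch_inf_tofrac c p : dvq 1 p -> qpoch_inf (tf c) (tf p) = tf (pochinf p c).
Proof.
move=> hp; have cv : qcvg (qpoch (tf c) (tf p)) (tf (pochinf p c)).
  move=> M; exists M => n Mn; rewrite -tf_poch -tfB; apply: qsmall_tofrac.
  by apply: dvq_le Mn _; apply/dvq_sym/pochinfP.
by apply: classical_sets.xget_subset1 => // l l' hl hl'; apply: qcvg_unique hl hl'.
Qed.

Lemma tf_inv f : f \is a GRing.unit -> tf f^-1 = (tf f)^-1.
Proof. exact: rmorphV. Qed.

Lemma tf_invpoch n : tf (invpoch (qR ^+ 2) n) = (qpoch (q ^+ 2) (q ^+ 2) n)^-1.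
Proof.
rewrite tf_inv ?tf_poch ?tfX //; apply: poch_unit; rewrite expr2;
  exact/dvq_mulr/qR_dvq.
Qed.

Lemma tf_w0 z n : tf (w (qR ^+ 2) z 0 n) = tf z ^+ n * q ^+ (2 * n ^ 2).
Proof.
elim: n => [|n IHn]; first by rewrite w0 tf1 mulr1.
rewrite wSr tfM IHn subr0 !tfM !tfX tfq -!exprM [_ ^+ n.+1]exprS.
have -> : (2 * n.+1 ^ 2 = 2 * n ^ 2 + 2 * n + 2 * n.+1)%N by rewrite !expnS; lia.
rewrite !exprD; ring.
Qed.

Let div_cancel (F : fieldType) (c u v : F) : c != 0 -> u != 0 ->
  c / (u * (c * v)) * u = v^-1.
Proof.
by move=> c0 u0; rewrite mulrCA !invfM mulVKf // mulrC mulVKf.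
Qed.

Let factor_step (F : fieldType) (d u v c t Q P : F) : v != 0 ->
  d * Q * P * (u * (t * (v * c) - t * - c)) = t * d * (Q * u * v * c) * (P * (1 + v^-1)).
Proof. by move=> v0; field. Qed.

Lemma tf_wa z n : tf (w (qR ^+ 2) z (z * - qR) n)
  = tf z ^+ n * q ^+ (2 * n ^ 2) * qpoch (- q ^ (1 - 2 * n%:Z)) (q ^+ 2) n.
Proof.
(* Reversing the product makes its factors independent of n, so that induction on n applies. *)
have -> : qpoch (- q ^ (1 - 2 * n%:Z)) (q ^+ 2) n
    = \prod_(0 <= t < n) (1 + (q ^+ (2 * t).+1)^-1).
  rewrite /qpoch big_nat_rev; apply: eq_big_nat => t /andP[_ tn].
  rewrite add0n mulNr opprK; congr (_ + _).
  have q0 := q_neq0.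
  have -> : q ^ (1 - 2 * n%:Z) = q / q ^+ (2 * n).
    by rewrite expfzDr // expr1z -PoszM -exprnN.
  have -> : (2 * n = 2 * (n - t.+1) + (2 * t).+2)%N by lia.
  by rewrite exprD -exprM [_ ^+ (2 * t).+2]exprS div_cancel ?expf_neq0.
elim: n => [|n IHn]; first by rewrite w0 big_nil tf1 !mulr1.
rewrite wSr tfM IHn big_nat_recr //= tfM tfB !tfM tfN !tfX tfq.
rewrite -!exprM [tf z ^+ n.+1]exprS.
have -> : (2 * n.+1 ^ 2 = 2 * n ^ 2 + 2 * n + (2 * n).+1 + 1)%N by rewrite !expnS; lia.
have -> : (2 * n.+1 = (2 * n).+1 + 1)%N by lia.
by rewrite !exprD expr1; apply: factor_step; rewrite expf_neq0 // q_neq0.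
Qed.

End FractionField.

(** * The partition side as a q-adic sum in [K] *)

Section PartitionSide.
Local Notation qR := (fpsX {poly int}).
Local Notation tf := (@tofrac ZXq).

Lemma numC_count j k i m n N : (n < N)%N ->
  numC j k i m n = count (fun l => (size l == m) && (sumn l == n)) (CC_below j k i N).
Proof.
move=> nN; rewrite /numC cardE -size_filter.
rewrite -(size_map (fun l : m.-tuple 'I_n.+1 => map val l)); apply: perm_size.
apply: uniq_perm.
- rewrite map_inj_uniq ?enum_uniq // => l l' /(inj_map val_inj) ll'.
  exact: val_inj.
- exact/filter_uniq/CC_below_uniq.
move=> l; rewrite mem_filter mem_CC_below.
apply/mapP/idP => [[t]|/and3P[/andP[/eqP sl /eqP nl] hl _]].
  rewrite mem_enum inE => /andP[/eqP st ht] ->.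
  by rewrite size_map size_tuple st !eqxx ht nN.
have lE : map val (pmap (insub : nat -> option 'I_n.+1) l) = l.
  rewrite (pmap_filter (insubK _)); apply/all_filterP/allP => y /leq_sumn yl.
  by rewrite insubT // ltnS -nl.
have sE : size (pmap (insub : nat -> option 'I_n.+1) l) == m.
  by rewrite -(size_map val) lE sl.
by exists (Tuple sE) => //; rewrite mem_enum inE lE nl eqxx.
Qed.

Lemma numC_eq0 j k i m n : (n < m)%N -> numC j k i m n = 0%N.
Proof.
move=> nm; rewrite (@numC_count j k i m n n.+1) //; apply/eqP.
rewrite -leqn0 leqNgt -has_count; apply/hasPn => l.
rewrite mem_CC_below => /andP[/asboolP/CC_partition/partition_size_sumn h _].
by apply/negP => /andP[/eqP sl /eqP nl]; lia.
Qed.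

Definition lhs_poly j k i (mn : nat * nat) : ZXq :=
  (numC j k i mn.1 mn.2)%:R * xR ^+ mn.1 * qR ^+ mn.2.

Lemma tf_lhs j k i mn : tf (lhs_poly j k i mn) = lhs_term j k i mn.
Proof. by rewrite !tfM !tfX /lhs_term rmorph_nat. Qed.

(** Partitions are grouped by number of parts and sum; as parts are positive, the box contains every
    pair that occurs for sum less than N. *)
Lemma sum_lhs_poly j k i N :
  \sum_(mn <- [seq (m, n) | m <- iota 0 N, n <- iota 0 N]) lhs_poly j k i mn
  = \sum_(l <- CC_below j k i N) weight xR l.
Proof.
pose key (l : seq nat) := (size l, sumn l).
set box := [seq _ | _ <- _, _ <- _].
have box_uniq : uniq box by apply: allpairs_uniq; rewrite ?iota_uniq // => -[? ?] [? ?].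
transitivity (\sum_(mn <- box) \sum_(l <- CC_below j k i N | key l == mn) weight xR l).
  apply: eq_big_seq => -[m n] /allpairsP[[m' n'] [_ nN [-> ->]]] /=.
  rewrite mem_iota /= in nN; rewrite /lhs_poly (@numC_count j k i _ _ N) //=.
  rewrite (eq_bigr (fun=> xR ^+ m' * qR ^+ n')) => [|l /eqP[<- <-] //].
  by rewrite big_const_seq iter_addr_0 -mulrA mulr_natl.
rewrite (exchange_big_dep xpredT) //=; apply: eq_big_seq => l.
rewrite mem_CC_below => /andP[/asboolP/CC_partition/partition_size_sumn sl lN].
rewrite -big_filter (_ : [seq mn <- box | key l == mn] = [:: key l]) ?big_seq1 //.
rewrite (eq_filter (a2 := pred1 (key l))) => [|mn]; last by rewrite /= eq_sym.
apply: filter_pred1_uniq => //; apply/allpairsP; exists (key l).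
by rewrite !mem_iota /=; split=> //; lia.
Qed.

Lemma lhs_has_qsum j k i : has_qsum xpredT (lhs_term j k i) (tf (CC_gf j k i xR)).
Proof.
move=> M; exists [seq (m, n) | m <- iota 0 M, n <- iota 0 M] => S' uS' sub.
rewrite -(eq_bigr _ (fun mn _ => tf_lhs j k i mn)) -rmorph_sum -tfB.
apply: qsmall_tofrac; apply: dvq_trans (dvq_sym (CC_gfP j k i xR M)).
rewrite -sum_lhs_poly (bigID (fun mn : nat * nat => (mn.1 < M)%N && (mn.2 < M)%N)) /=.
rewrite -[X in X + _ - _]big_filter.
rewrite (perm_big [seq (m, n) | m <- iota 0 M, n <- iota 0 M]) /=.
  rewrite addrAC subrr add0r; apply: dvq_sum => -[m n] _ /=; rewrite negb_and -!leqNgt => mn.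
  (* Outside the box either q^M divides the term, or n < M <= m and no partition of n has m
     parts. *)
  have [Mn|nM] := leqP M n.
    by apply/dvq_mull; apply: dvq_le Mn _; exists 1; rewrite mulr1.
  rewrite /lhs_poly numC_eq0 /= ?mul0r; first exact: dvq0.
  by case/orP: mn; lia.
apply: uniq_perm; first exact: filter_uniq.
  by apply: allpairs_uniq; rewrite ?iota_uniq // => -[? ?] [? ?].
move=> [m n]; rewrite mem_filter; apply/andP/idP => [[/= /andP[mM nM] _]|h].
  by apply/allpairsP; exists (m, n); rewrite !mem_iota.
split; last exact: sub.
by case/allpairsP: h => -[m' n'] /= [+ + [-> ->]]; rewrite !mem_iota /= => -> ->.
Qed.

End PartitionSide.

(** * The multiple sum as a sum over decreasing chains *)

Fixpoint chains (l L : nat) : seq (seq nat) :=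
  if l is l'.+1 then [seq s :: t | s <- iota 0 L.+1, t <- chains l' s] else [:: [::]].

Lemma chainsS l L :
  chains l.+1 L = [seq s :: t | s <- iota 0 L.+1, t <- chains l s].
Proof. by []. Qed.

Lemma mem_chains l L t : (t \in chains l L) = (size t == l) && path geq L t.
Proof.
elim: l L t => [|l IHl] L [|s t] //; rewrite chainsS.
  by apply/negbTE/negP => /allpairsPdep[? [? []]].
apply/allpairsPdep/and3P => [[s' [t' [+ + [-> ->]]]]|[st sL pt]].
  by rewrite mem_iota IHl => /andP[_ sL] /andP[st pt]; split.
by exists s, t; rewrite mem_iota IHl; split=> //; apply/andP.
Qed.

Lemma chains_uniq l L : uniq (chains l L).
Proof.
elim: l L => // l IHl L; rewrite chainsS; apply: allpairs_uniq_dep; rewrite ?iota_uniq //.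
by move=> [s t] [s' t'] _ _ /= [-> ->].
Qed.

Section ChainSide.
Variable A : idomainType.
Local Notation R := (fps A).
Variables (p a b : R) (i : nat) (z : R).

Definition link r s : R :=
  w p (if (i <= r)%N then z * p else z)
    (if r == 2 then (if (i <= r)%N then z * p else z) * a else 0) s.

Fixpoint chain_weight r L (t : seq nat) : R :=
  if t is s :: t' then link r s * invpoch p (L - s) * chain_weight r.+1 s t'
  else invpoch p L * (poch p (b * p) L)^-1.

Lemma nest_chains r l L :
  nest p a b i z r l L = \sum_(t <- chains l L) chain_weight r L t.
Proof.
elim: l r L => [|l IHl] r L; first by rewrite big_seq1.
rewrite nestS chainsS big_allpairs_dep; apply: eq_bigr => s _.
by rewrite IHl mulr_sumr.
Qed.

Lemma chain_weightE r L t : chain_weight r L t =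
  (\prod_(0 <= l < size t) link (r + l) (nth 0%N t l))
  * (\prod_(0 <= l < size t) invpoch p (nth 0%N (L :: t) l - nth 0%N t l))
  * (invpoch p (last L t) * (poch p (b * p) (last L t))^-1).
Proof.
elim: t r L => [|s t IHt] r L; first by rewrite !big_nil !mul1r.
rewrite [chain_weight _ _ _]/= IHt !big_nat_recl //= addn0.
rewrite (eq_bigr (fun l => link (r + l.+1) (nth 0%N t l))) => [|l _]; last by rewrite addnS.
ring.
Qed.

Definition multisum_term (N : seq nat) : R :=
  w p z 0 (head 0%N N) * pochinf p (a * z * p ^+ head 0%N N)
  * chain_weight 2 (head 0%N N) (behead N).

Hypothesis p_dvq : dvq 1 p.

Lemma multisum_term_dvq M N : (M <= head 0%N N)%N -> dvq M (multisum_term N).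
Proof. by move=> MN; apply/dvq_mulr/dvq_mulr; apply: dvq_le MN _; apply/w_summable/dvq0. Qed.

Lemma multisum_chains k M : (1 < k)%N ->
  dvq M.+1 (multisum p a b k i z - \sum_(N <- chains (k - 1) M) multisum_term N).
Proof.
move=> k1; have -> : \sum_(N <- chains (k - 1) M) multisum_term N
  = \sum_(0 <= N < M.+1) w p z 0 N * pochinf p (a * z * p ^+ N) * nest p a b i z 2 (k - 2) N.
  rewrite (_ : k - 1 = (k - 2).+1)%N; last by lia.
  rewrite chainsS big_allpairs_dep /index_iota subn0; apply: eq_bigr => N _.
  by rewrite nest_chains mulr_sumr.
by apply: qsumP; apply/summableMr/summableMr/w_summable/dvq0.
Qed.

End ChainSide.

(** * The summands of the multiple sum in [K] *)

Section Transfer.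
Local Notation qR := (fpsX {poly int}).
Local Notation tf := (@tofrac ZXq).
Variables (j k i : nat).
Hypotheses (hj : j = 0%N \/ j = 1%N) (i2 : (1 < i)%N) (ik : (i <= k)%N).

Local Notation p := (qR ^+ 2).
Local Notation b := (- ((j == 0)%N%:R) : ZXq).
Local Notation term := (multisum_term p (- qR) b i xR).

Let p_dvq : dvq 1 p.
Proof. by rewrite expr2; apply/dvq_mulr/qR_dvq. Qed.

Lemma tf_link r s : tf (link p (- qR) i xR r s) =
  x ^+ s * q ^+ (2 * s ^ 2 + (i <= r)%N * (2 * s))
  * (if r == 2 then qpoch (- q ^ (1 - 2 * s%:Z)) (q ^+ 2) s else 1).
Proof.
have zE : tf (if (i <= r)%N then xR * p else xR) ^+ s * q ^+ (2 * s ^ 2)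
   = x ^+ s * q ^+ (2 * s ^ 2 + (i <= r)%N * (2 * s)).
  case: (i <= r)%N; last by rewrite mul0n addn0.
  by rewrite tfM tfX tfx tfq exprMn -exprM mul1n -mulrA -exprD addnC.
rewrite /link; case: eqP => _; first by rewrite tf_wa zE.
by rewrite tf_w0 zE mulr1.
Qed.

Lemma tf_last L : tf (invpoch p L * (poch p (b * p) L)^-1)
  = (qpoch (q ^+ (4 - 2 * j)) (q ^+ (4 - 2 * j)) L)^-1.
Proof.
have bu : poch p (b * p) L \is a GRing.unit by apply: poch_unit => //; apply: dvq_mull.
rewrite tfM tf_invpoch tf_inv // tf_poch tfM tfN tfX tfq -invfM; congr (_^-1).
(* For j = 1 the second symbol is 1, as b = 0; for j = 0, (p;p)_L (-p;p)_L = (p^2;p^2)_L with p^2 =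
   q^4. *)
case: hj => ->; last first.
  rewrite oppr0 mul0r /= /qpoch [X in _ * X]big1 ?mulr1 // => m _.
  by rewrite mul0r subr0.
rewrite /= tf1 /qpoch -big_split /=; apply: eq_bigr => m _.
rewrite -[q ^+ 4]/(q ^+ (2 * 2)) exprM [(q ^+ 2) ^+ 2 ^+ m]exprAC; ring.
Qed.

Lemma tf_pochinf n : tf (pochinf p (- qR * xR * p ^+ n))
  = qpoch_inf (- (x * q ^+ (1 + 2 * n))) (q ^+ 2).
Proof.
have <- : tf (- qR * xR * p ^+ n) = - (x * q ^+ (1 + 2 * n)).
  by rewrite !tfM tfN !tfX tfq tfx exprD expr1 exprM mulNr mulNr mulrCA mulrA.
by rewrite -tfq -tfX (qpoch_inf_tofrac _ p_dvq).
Qed.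

Lemma tf_multisum_term (N : (k - 1).-tuple nat) : tf (term N) = rhs_term j i N.
Proof.
have k1 : (1 < k)%N by apply: leq_trans ik.
case: N => -[|n t] st; first by move: (st) => /=; lia.
have tk : size t = (k - 2)%N by move/eqP: (st) => /=; lia.
rewrite /rhs_term /multisum_term -[tval (Tuple st)]/(n :: t) [head _ _]/= [behead _]/=.
rewrite 2!tfM tf_pochinf tf_w0 tfx chain_weightE 2!tfM tf_last.
set e := qpoch_inf _ _; rewrite tk.
have -> : last n t = Nr (n :: t) (k - 1).
  by rewrite /Nr (_ : (k - 1).-1 = size t) ?nth_last //; lia.
have -> : tf (\prod_(0 <= l < k - 2) invpoch p (nth 0%N (n :: t) l - nth 0%N t l))
   = (\prod_(1 <= r < k - 1) qpoch (q ^+ 2) (q ^+ 2) (Nr (n :: t) r - Nr (n :: t) r.+1))^-1.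
  rewrite rmorph_prod -prodfV (big_addn 0 _ 1) -subnDA /=.
  by apply: eq_bigr => l _; rewrite tf_invpoch addn1.
have s1 : (\sum_(1 <= r < k) Nr (n :: t) r = n + \sum_(0 <= l < k - 2) nth 0%N t l)%N.
  by rewrite big_ltn // !big_add1 -subn2.
(* As i >= 2, N_1 does not occur in N_i + ... + N_(k-1). *)
have s2 : (2 * (\sum_(1 <= r < k) Nr (n :: t) r ^ 2 + \sum_(i <= r < k) Nr (n :: t) r)
  = 2 * n ^ 2 + \sum_(0 <= l < k - 2)
       (2 * nth 0 t l ^ 2 + (i <= 2 + l) * (2 * nth 0 t l)))%N.
  rewrite (big_nat_widenl i 1 k) 1?ltnW // [X in (_ + X)%N]big_mkcond -big_split big_distrr /=.
  rewrite big_ltn // !big_add1 -subn2 leqNgt i2 addn0; congr addn.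
  apply: eq_bigr => l _; rewrite /Nr /= mulnDr; congr addn.
  by case: ifP => _; lia.
rewrite s1 s2.
have -> : tf (\prod_(0 <= l < k - 2) link p (- qR) i xR (2 + l) (nth 0%N t l))
  = x ^+ (\sum_(0 <= l < k - 2) nth 0%N t l)
    * q ^+ (\sum_(0 <= l < k - 2) (2 * nth 0 t l ^ 2 + (i <= 2 + l) * (2 * nth 0 t l)))
    * qpoch (- q ^ (1 - 2 * (Nr (n :: t) 2)%:Z)) (q ^+ 2) (Nr (n :: t) 2).
  rewrite rmorph_prod /=; under eq_bigr do rewrite tf_link.
  rewrite [LHS]big_split [X in X * _ = _]big_split /= -!expr_sum; congr (_ * _).
  (* For k = 2 the default N_2 = 0 gives an empty product; otherwise only r = 2 contributes a
     Pochhammer symbol. *)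
  case: (k - 2)%N tk => [|m] tm.
    by rewrite (size0nil tm) /Nr /= /qpoch !big_nil.
  rewrite big_nat_recl //= big1 ?mulr1 //.
rewrite !exprD invfM; ring.
Qed.

End Transfer.

Section MultisumSide.
Local Notation qR := (fpsX {poly int}).
Local Notation tf := (@tofrac ZXq).
Variables (j k i : nat).
Hypotheses (hj : j = 0%N \/ j = 1%N) (i2 : (1 < i)%N) (ik : (i <= k)%N).

Local Notation p := (qR ^+ 2).
Local Notation b := (- ((j == 0)%N%:R) : ZXq).
Local Notation term := (multisum_term p (- qR) b i xR).

Let p_dvq : dvq 1 p.
Proof. by rewrite expr2; apply/dvq_mulr/qR_dvq. Qed.

(** For precision M the chains with N_1 <= M suffice: the summand of any other chain is divisible by
    q^M. *)
Lemma rhs_has_qsum :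
  has_qsum (@chain (k - 1)) (@rhs_term j k i) (tf (multisum p (- qR) b k i xR)).
Proof.
move=> M; have k1 : (1 < k)%N by apply: leq_trans ik.
pose S := chains (k - 1) M; exists (pmap insub S) => S' uS' sub.
rewrite (eq_bigr (fun N : (k - 1).-tuple nat => tf (term N))); last first.
  by move=> N _; rewrite tf_multisum_term.
rewrite -rmorph_sum -tfB; apply: qsmall_tofrac.
have := multisum_chains (- qR) b i xR p_dvq M k1.
move/(dvq_le (leqnSn M))/dvq_sym; apply: dvq_trans.
rewrite (bigID (fun N : (k - 1).-tuple nat => (head 0%N N <= M)%N)) /=.
have -> : \sum_(N <- S' | chain N && (head 0%N N <= M)%N) term N = \sum_(N <- S) term N.
  rewrite -big_filter -(big_map val xpredT term); apply: perm_big; apply: uniq_perm.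
  - by rewrite map_inj_uniq ?filter_uniq //; apply: val_inj.
  - exact: chains_uniq.
  move=> s; apply/mapP/idP => [[N] | sS].
    rewrite mem_filter => /andP[/andP[cN hN] _] ->; rewrite mem_chains size_tuple eqxx /=.
    by move: cN hN; rewrite /chain; case: (tval N) => //= n t -> ->.
  move: (sS); rewrite mem_chains => /andP[/eqP ss ps].
  have sz : size s == (k - 1)%N by rewrite ss.
  exists (Tuple sz) => //; rewrite mem_filter; apply/andP; split.
    by rewrite /chain /=; case: (s) ps => //= n t /andP[-> ->].
  by apply: sub; rewrite mem_pmap; apply/mapP; exists s => //; rewrite insubT.
rewrite addrAC subrr add0r; apply: dvq_sum => N _ /andP[_]; rewrite -ltnNge => MN.
by apply: multisum_term_dvq => //; apply: ltnW.
Qed.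

End MultisumSide.

Theorem theorem1p7 (j k i : nat)
    (hj : j = 0%N \/ j = 1%N)
    (hi : (2 <= i)%N) (hik : (i <= k)%N)
    (hkj : 2 < ((2 * k + j)%N%:R / 2 : rat)) :
  exists S : K,
    has_qsum xpredT (lhs_term j k i) S /\
    has_qsum (@chain (k - 1)) (@rhs_term j k i) S.
Proof.
exists (tofrac (CC_gf j k i xR)); split; first exact: lhs_has_qsum.
have k1 : (1 < k)%N by apply: leq_trans hik.
have p_dvq : dvq 1 (fpsX {poly int} ^+ 2) by rewrite expr2; apply/dvq_mulr/qR_dvq.
have p0 : fpsX {poly int} ^+ 2 != 0 by rewrite expf_neq0 ?qR_neq0.
(* For j = 0 the hypothesis [hkj] says k > 2; for j = 1 the bound k > 1 is [k1]. *)
have ke : (if (j == 0)%N then 2 < k else 1 < k)%N.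
  case: hj hkj => -> //=; rewrite addn0 natrM mulrC mulKf // => k2.
  by rewrite -(Num.Theory.ltr_nat rat).
rewrite (ladder_rec_multisum p_dvq p0 ke (@CC_gf_rec _ j k)) ?xR_neq0 ?hi //.
  exact: rhs_has_qsum.
exact: CC_gf_tends_to_1.
Qed.
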